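(* There is a bijective correspondence between module connections on $M$ and tangent category connections on the differential bundle $\mathsf q_M$ in the tangent category of affine schemes over $R$. Explicitly, a module connection $\nabla$ is sent to $(\mathsf K_\nabla,\mathsf H_\nabla)$, and a connection $(\mathsf K,\mathsf H)$ is sent to $\nabla_{\mathsf H}$, $\nabla_{\mathsf H}(m)=\mathsf H(\mathsf d(m))$; these are mutually inverse, and in particular $\nabla\mapsto\mathsf H_\nabla$ is a bijection between module connections on $M$ and horizontal connections on $\mathsf q_M$ with inverse $\mathsf H\mapsto\nabla_{\mathsf H}$.
   Context: Fix a commutative ring $R$, a commutative $R$-algebra $A$ and an $A$-module $M$. ''Algebra'' means commutative $R$-algebra and ''algebra map'' means $R$-algebra homomorphism. $\Omega(A)$ is the $A$-module of Kähler differentials of $A$ over $R$, with universal derivation $\mathsf d:A\to\Omega(A)$. A (module) connection on $M$ is an $R$-linear map $\nabla:M\to\Omega(A)\otimes_AM$ such that $\nabla(am)=a\nabla(m)+\mathsf d(a)\otimes_Am$ for all $a\in A$, $m\in M$. Tangent algebras: for an algebra $B$, $\mathsf T(B):=\mathrm{Sym}_B(\Omega(B))$, i.e. the $B$-algebra generated by symbols $\mathsf d(b)$ ($b\in B$) subject to $\mathsf d(b+b')=\mathsf d(b)+\mathsf d(b')$, $\mathsf d(bb')=b\,\mathsf d(b')+b'\,\mathsf d(b)$, $\mathsf d(r1)=0$ ($r\in R$). An algebra map out of $\mathsf T(B)$ is determined by its values on the generators $b$, $\mathsf d(b)$. Write $\mathsf T^2(B)=\mathsf T(\mathsf T(B))$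 and denote the universal derivation $\mathsf T(B)\to\mathsf T^2(B)$ by $\mathsf d'$; so $\mathsf T^2(B)$ is generated over $B$ by $\mathsf d(b),\mathsf d'(b),\mathsf d'\mathsf d(b)$. For an algebra map $h:X\to Y$, $\mathsf T(h):\mathsf T(X)\to\mathsf T(Y)$ sends $x\mapsto h(x)$ and $\delta_X(x)\mapsto\delta_Y(h(x))$, where $\delta$ denotes the relevant universal derivation ($\mathsf d$ for $B\to\mathsf T(B)$, $\mathsf d'$ for $\mathsf T(B)\to\mathsf T^2(B)$). Algebra maps defined on generators $b\in B$: $\mathsf p_B:B\to\mathsf T(B)$ the inclusion; $0_B:\mathsf T(B)\to B$, $b\mapsto b$, $\mathsf d(b)\mapsto 0$; $\ell_B:\mathsf T^2(B)\to\mathsf T(B)$, $b\mapsto b$, $\mathsf d(b)\mapsto 0$, $\mathsf d'(b)\mapsto0$, $\mathsf d'\mathsf d(b)\mapsto\mathsf d(b)$; $\mathsf c_B:\mathsf T^2(B)\to\mathsf T^2(B)$, $b\mapsto b$, $\mathsf d(b)\mapsto\mathsf d'(b)$, $\mathsf d'(b)\mapsto\mathsf d(b)$, $\mathsf d'\mathsf d(b)\mapsto\mathsf d'\mathsf d(b)$. (These are, read in algebras, the structure maps of the Rosický tangent structure on affine schemes over $R$, i.e. on the opposite of the category of commutative $R$-algebras.) Differential bundle of $M$: $\mathsf S_A(M)$ is the symmetric $A$-algebra on $M$ (generated by $a\in A$, $m\in M$). Algebra maps: $\mathsf q_M:A\to\mathsf S_A(M)$ the inclusion; $\mathsf z_M:\mathsf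 S_A(M)\to A$, $a\mapsto a$, $m\mapsto 0$; $\lambda_M:\mathsf T(\mathsf S_A(M))\to\mathsf S_A(M)$, $a\mapsto a$, $m\mapsto0$, $\mathsf d(a)\mapsto 0$, $\mathsf d(m)\mapsto m$. Let $U:\mathsf T(A)\otimes_A\mathsf S_A(M)\to\mathsf T(\mathsf S_A(M))$ be the algebra map $w\otimes v\mapsto\mathsf T(\mathsf q_M)(w)\,v$ (we regard $\Omega(A)\otimes_AM\subseteq\mathsf T(A)\otimes_A\mathsf S_A(M)$). A horizontal connection on $\mathsf q_M$ is an algebra map $\mathsf H:\mathsf T(\mathsf S_A(M))\to\mathsf T(A)\otimes_A\mathsf S_A(M)$ such that (H1) $\mathsf H(\mathsf T(\mathsf q_M)(w))=w\otimes1$ for all $w\in\mathsf T(A)$; (H2) $\mathsf H(v)=1\otimes v$ for all $v\in\mathsf S_A(M)$; (H3) $(\ell_A\otimes0_{\mathsf S_A(M)})\circ\theta\circ\mathsf T(\mathsf H)=\mathsf H\circ\ell_{\mathsf S_A(M)}$; (H4) $(0_{\mathsf T(A)}\otimes\lambda_M)\circ\theta\circ\mathsf T(\mathsf H)=\mathsf H\circ\mathsf T(\lambda_M)\circ\mathsf c_{\mathsf S_A(M)}$. Here $\mathsf T^2(A)\otimes_{\mathsf T(A)}\mathsf T(\mathsf S_A(M))$ is formed via $\mathsf T(\mathsf p_A):\mathsf T(A)\to\mathsf T^2(A)$ ($a\mapsto a$, $\mathsf d(a)\mapsto\mathsf d'(a)$) and $\mathsf T(\mathsf q_M)$; $\theta:\mathsf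 T(\mathsf T(A)\otimes_A\mathsf S_A(M))\to\mathsf T^2(A)\otimes_{\mathsf T(A)}\mathsf T(\mathsf S_A(M))$ is the canonical isomorphism, $w\otimes v\mapsto w\otimes v$, $\mathsf d(w\otimes v)\mapsto\mathsf d'(w)\otimes v+w\otimes\mathsf d(v)$; the maps $\ell_A\otimes0_{\mathsf S_A(M)}$ and $0_{\mathsf T(A)}\otimes\lambda_M$ into $\mathsf T(A)\otimes_A\mathsf S_A(M)$ are induced factorwise, where $0_{\mathsf T(A)}:\mathsf T^2(A)\to\mathsf T(A)$ sends $a\mapsto a$, $\mathsf d(a)\mapsto\mathsf d(a)$, $\mathsf d'(a)\mapsto0$, $\mathsf d'\mathsf d(a)\mapsto0$. A vertical connection on $\mathsf q_M$ is an algebra map $\mathsf K:\mathsf S_A(M)\to\mathsf T(\mathsf S_A(M))$ such that (K1) $\lambda_M\circ\mathsf K=\mathrm{id}$; (K2) $\mathsf K(a)=a$ for all $a\in A$; (K3) $\ell_{\mathsf S_A(M)}\circ\mathsf T(\mathsf K)=\mathsf K\circ\lambda_M$; (K4) $\mathsf T(\lambda_M)\circ\mathsf c_{\mathsf S_A(M)}\circ\mathsf T(\mathsf K)=\mathsf K\circ\lambda_M$. A (tangent category) connection on $\mathsf q_M$ is a pair $(\mathsf K,\mathsf H)$ of a vertical and a horizontal connection on $\mathsf q_M$ such that $\mathsf H\circ\mathsf K=\iota_1\circ\mathsf q_M\circ\mathsf z_M$ (where $\iota_1(v)=1\otimes v$), i.e. $\mathsf H(\mathsf K(m))=0$ for $m\in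 M$, and $\mathsf K(m)+U(\mathsf H(\mathsf d(m)))=\mathsf d(m)$ for all $m\in M$. Given a module connection $\nabla$ on $M$: $\mathsf H_\nabla:\mathsf T(\mathsf S_A(M))\to\mathsf T(A)\otimes_A\mathsf S_A(M)$ is the algebra map with $a\mapsto a\otimes1$, $m\mapsto 1\otimes m$, $\mathsf d(a)\mapsto\mathsf d(a)\otimes 1$, $\mathsf d(m)\mapsto\nabla(m)$; and $\mathsf K_\nabla:\mathsf S_A(M)\to\mathsf T(\mathsf S_A(M))$ is the algebra map with $a\mapsto a$, $m\mapsto\mathsf d(m)-U(\nabla(m))$. *)

(* Defs.v *)
From HB Require Import structures.
From mathcomp Require Import all_boot all_order all_algebra.
From mathcomp Require Import generic_quotient ring_quotient.
From mathcomp Require Import monalg.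
From Stdlib Require Import ClassicalEpsilon.
Set Implicit Arguments. Unset Strict Implicit. Unset Printing Implicit Defensive.
Import GRing.Theory.
Local Open Scope ring_scope.
Local Open Scope quotient_scope.

Definition asb (P : Prop) : bool := if excluded_middle_informative P then true else false.
Lemma asbP (P : Prop) : reflect P (asb P).
Proof. by rewrite /asb; case: excluded_middle_informative => h; constructor. Qed.

Definition FreeR (R : comNzRingType) (X : choiceType) := {malg R[{cmonom X}]}.

Definition in_ideal (R : comNzRingType) (X : choiceType) (rels : FreeR R X -> Prop)
    (p : FreeR R X) : Prop :=
  exists s : seq (FreeR R X * FreeR R X),
    (forall c, c \in s -> rels c.2) /\ p = \sum_(c <- s) c.1 * c.2.

Definition idealb (R : comNzRingType) (X : choiceType) (rels : FreeR R X -> Prop)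
  : {pred FreeR R X} := fun p => asb (in_ideal rels p).

Section Ideal.
Variables (R : comNzRingType) (X : choiceType) (rels : FreeR R X -> Prop).
Lemma idealb_zmod : zmod_closed (idealb rels).
Proof.
split; first by apply/asbP; exists [::]; rewrite big_nil.
move=> u v /asbP [s [hs ->]] /asbP [t [ht ->]]; apply/asbP.
exists (s ++ [seq (- c.1, c.2) | c <- t]); split.
 move=> c; rewrite mem_cat => /orP [/hs //|/mapP [c' /ht h ->] //].
rewrite big_cat /= big_map.
congr (_ + _).
rewrite -sumrN.
apply: eq_bigr => c _.
by rewrite mulNr.
Qed.
Lemma idealb_mulr u v : u \in idealb rels -> u * v \in idealb rels.
Proof.
move=> /asbP [s [hs ->]]; apply/asbP.
exists [seq (c.1 * v, c.2) | c <- s]; split.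
  by move=> c /mapP [c' /hs h ->].
rewrite big_map big_distrl /=.
apply: eq_bigr => c _.
exact: mulrAC.
Qed.
End Ideal.

HB.instance Definition _ (R : comNzRingType) (X : choiceType) (rels : FreeR R X -> Prop) :=
  GRing.isZmodClosed.Build (FreeR R X) (idealb rels) (idealb_zmod rels).

Lemma mul_sub_aux (T : comPzRingType) (a b c d : T) :
  a * b - c * d = (b - d) * a + (a - c) * d.
Proof. by rewrite !mulrBl [b * a]mulrC [d * a]mulrC addrA subrK. Qed.

Section Quot.
Variables (R : comNzRingType) (X : choiceType) (rels : FreeR R X -> Prop).
Local Notation I := (idealb rels).
Definition PresZ := Quotient.quot I.

Definition pone : PresZ := lift_cst PresZ 1.
Definition pmul := lift_op2 PresZ *%R.
Canonical pi_one_morph := PiConst pone.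

Lemma pi_mul: {morph \pi_PresZ : x y / x * y >-> pmul x y}.
Proof.
move=> x y; unlock pmul; apply/eqP; rewrite piE Quotient.equivE.
rewrite (mul_sub_aux x y (repr (\pi_PresZ x)) (repr (\pi_PresZ y))).
rewrite rpredD // idealb_mulr //.
  by rewrite Quotient.idealrBE reprK.
by rewrite Quotient.idealrBE reprK.
Qed.
Canonical pi_mul_morph := PiMorph2 pi_mul.

Lemma mulqA: associative pmul.
Proof. by move=> x y z; rewrite -[x]reprK -[y]reprK -[z]reprK !piE mulrA. Qed.
Lemma mulqC: commutative pmul.
Proof. by move=> x y; rewrite -[x]reprK -[y]reprK !piE mulrC. Qed.
Lemma mul1q: left_id pone pmul.
Proof. by move=> x; rewrite -[x]reprK !piE mul1r. Qed.
Lemma mulq_addl: left_distributive pmul +%R.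
Proof.
move=> x y z; rewrite -[x]reprK -[y]reprK -[z]reprK.
by rewrite !piE mulrDl.
Qed.
End Quot.

Definition Pres (R : comNzRingType) (X : choiceType) (rels : FreeR R X -> Prop) := PresZ rels.
HB.instance Definition _ R X rels := GRing.Zmodule.on (@Pres R X rels).
HB.instance Definition _ R X rels := GRing.Zmodule_isComPzRing.Build (@Pres R X rels)
  (@mulqA R X rels) (@mulqC R X rels) (@mul1q R X rels) (@mulq_addl R X rels).

Record ralg (R : comNzRingType) := RAlg {
  ralg_sort :> comPzRingType;
  ralg_s : R -> ralg_sort }.

Section Algebras.
Variable R : comNzRingType.

Definition is_alg_map (B C : ralg R) (f : B -> C) : Prop :=
  [/\ forall x y, f (x + y) = f x + f y,
      forall x y, f (x * y) = f x * f y,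
      f 1 = 1 &
      forall r, f (ralg_s B r) = ralg_s C r].

(* The (unique) function satisfying a specification, when there is one.     *)
(* Used below to name the algebra map determined by its values on         *)
(* generators, exactly as in the paper.                                    *)
Definition the_map (B C : ralg R) (P : (B -> C) -> Prop) : B -> C :=
  epsilon (inhabits (fun _ => 0)) P.

Definition fgen (X : choiceType) (x : X) : FreeR R X := << ucm x >>.
Definition ppi (X : choiceType) (rels : FreeR R X -> Prop) (p : FreeR R X)
  : Pres rels := \pi_(PresZ rels) p.
Definition PresAlg (X : choiceType) (rels : FreeR R X -> Prop) : ralg R :=
  @RAlg R (Pres rels) (fun r => ppi rels (r%:A)).
Definition pgen (X : choiceType) (rels : FreeR R X -> Prop) (x : X) : PresAlg rels :=
  ppi rels (fgen x).

(* relations saying that j : C -> X induces an R-algebra map C -> Pres. *)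
Definition hom_rels (C : ralg R) (X : choiceType) (j : C -> X) (p : FreeR R X) : Prop :=
  [\/ exists b b', p = fgen (j (b + b')) - fgen (j b) - fgen (j b'),
      exists b b', p = fgen (j (b * b')) - fgen (j b) * fgen (j b'),
      p = fgen (j 1) - 1 |
      exists r, p = fgen (j (ralg_s C r)) - r%:A].

(* Tangent algebra T(B) = Sym_B(Omega(B)): generated by b and d(b). *)
Definition T_rels (B : ralg R) (p : FreeR R (B + B)%type) : Prop :=
  [\/ hom_rels (@inl B B) p,
      exists b b', p = fgen (inr (b + b')) - fgen (inr b) - fgen (inr b'),
      exists b b', p = fgen (inr (b * b')) - fgen (inl b) * fgen (inr b')
                                           - fgen (inl b') * fgen (inr b) |
      exists r, p = fgen (inr (ralg_s B r))].
Definition TT (B : ralg R) : ralg R := PresAlg (@T_rels B).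
Definition tI (B : ralg R) (b : B) : TT B := pgen (@T_rels B) (inl b).
Definition tD (B : ralg R) (b : B) : TT B := pgen (@T_rels B) (inr b).

(* p_B : B -> T(B) is tI; 0_B : T(B) -> B *)
Definition zeroT (B : ralg R) : TT B -> B :=
  @the_map (TT B) B (fun f => [/\ is_alg_map f, forall b, f (tI b) = b &
                                      forall b, f (tD b) = 0]).
Definition TF (B C : ralg R) (h : B -> C) : TT B -> TT C :=
  @the_map (TT B) (TT C) (fun f => [/\ is_alg_map f, forall b, f (tI b) = tI (h b) &
                                      forall b, f (tD b) = tD (h b)]).
(* In T^2(B) = T(T(B)):  b = tI (tI b), d(b) = tI (tD b),
   d'(b) = tD (tI b), d'd(b) = tD (tD b). *)
Definition ellT (B : ralg R) : TT (TT B) -> TT B :=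
  @the_map (TT (TT B)) (TT B) (fun f => [/\ is_alg_map f,
                        forall b, f (tI (tI b)) = tI b,
                        forall b, f (tI (tD b)) = 0,
                        forall b, f (tD (tI b)) = 0 &
                        forall b, f (tD (tD b)) = tD b]).
Definition flipT (B : ralg R) : TT (TT B) -> TT (TT B) :=
  @the_map (TT (TT B)) (TT (TT B)) (fun f => [/\ is_alg_map f,
                        forall b, f (tI (tI b)) = tI (tI b),
                        forall b, f (tI (tD b)) = tD (tI b),
                        forall b, f (tD (tI b)) = tI (tD b) &
                        forall b, f (tD (tD b)) = tD (tD b)]).

Definition Tens_rels (B C D : ralg R) (f : B -> C) (h : B -> D)
    (p : FreeR R (C + D)%type) : Prop :=
  [\/ hom_rels (@inl C D) p, hom_rels (@inr C D) p |
      exists b, p = fgen (inl (f b)) - fgen (inr (h b))].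
Definition Tens (B C D : ralg R) (f : B -> C) (h : B -> D) : ralg R :=
  PresAlg (Tens_rels f h).
Definition tens (B C D : ralg R) (f : B -> C) (h : B -> D) (c : C) (d : D)
  : Tens f h :=
  pgen (Tens_rels f h) (inl c) * pgen (Tens_rels f h) (inr d).

End Algebras.

Section Bundle.
Variables (R : comNzRingType) (A : comAlgType R) (M : lmodType A).

Definition RA : ralg R := @RAlg R A (fun r => r%:A).

(* S_A(M), the symmetric A-algebra on M *)
Definition S_rels (p : FreeR R (A + M)%type) : Prop :=
  [\/ @hom_rels R RA (A + M)%type inl p,
      exists m m', p = @fgen R _ (inr (m + m')) - @fgen R _ (inr m) - @fgen R _ (inr m') |
      exists (a : A) (m : M), p = @fgen R _ (inr (a *: m)) - @fgen R _ (inl a) * @fgen R _ (inr m)].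
Definition SA : ralg R := PresAlg S_rels.
Definition sq (a : RA) : SA := pgen S_rels (inl a).
Definition sm (m : M) : SA := pgen S_rels (inr m).

Definition TA : ralg R := TT RA.
Definition pA (a : RA) : TA := tI a.
Definition TS : ralg R := TT SA.

Definition zM : SA -> RA :=
  @the_map R SA RA (fun f => [/\ is_alg_map f, forall a, f (sq a) = a &
                                      forall m, f (sm m) = 0]).
Definition lamM : TS -> SA :=
  @the_map R TS SA (fun f => [/\ is_alg_map f,
                        forall a, f (tI (sq a)) = sq a,
                        forall m, f (tI (sm m)) = 0,
                        forall a, f (tD (sq a)) = 0 &
                        forall m, f (tD (sm m)) = sm m]).

Definition TAS : ralg R := Tens pA sq.
Definition tAS (w : TA) (v : SA) : TAS := tens pA sq w v.

Definition UM : TAS -> TS :=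
  @the_map R TAS TS (fun f => is_alg_map f /\
                    forall w v, f (tAS w v) = TF sq w * tI v).

(* Omega(A) (x)_A M, regarded inside T(A) (x)_A S_A(M):
   the sums of elementary tensors d(a) (x) m. *)
Definition OmegaM (x : TAS) : Prop :=
  exists s : seq (A * M), x = \sum_(p <- s) tAS (@tD R RA p.1) (sm p.2).

Definition module_connection (nab : M -> TAS) : Prop :=
  [/\ forall m, OmegaM (nab m),
      forall m m', nab (m + m') = nab m + nab m',
      forall (r : R) m, nab ((r%:A : A) *: m) = ralg_s TAS r * nab m &
      forall (a : A) m, nab (a *: m) = tAS (@tI R RA a) 1 * nab m + tAS (@tD R RA a) (sm m)].

Definition T2A : ralg R := TT TA.
Definition B2 : ralg R := Tens (TF pA) (TF sq).
Definition tB2 (x : T2A) (y : TS) : B2 := tens (TF pA) (TF sq) x y.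

Definition thetaM : TT TAS -> B2 :=
  @the_map R (TT TAS) B2 (fun f => [/\ is_alg_map f,
     forall w v, f (tI (tAS w v)) = tB2 (tI w) (tI v) &
     forall w v, f (tD (tAS w v)) = tB2 (tD w) (tI v) + tB2 (tI w) (tD v)]).

Definition ell_zero : B2 -> TAS :=
  @the_map R B2 TAS (fun f => is_alg_map f /\
     forall x y, f (tB2 x y) = tAS (ellT x) (zeroT y)).
Definition zero_lam : B2 -> TAS :=
  @the_map R B2 TAS (fun f => is_alg_map f /\
     forall x y, f (tB2 x y) = tAS (zeroT x) (lamM y)).

Definition horizontal (H : TS -> TAS) : Prop :=
  [/\ is_alg_map H,
      forall w : TA, H (TF sq w) = tAS w 1,
      forall v : SA, H (tI v) = tAS 1 v,
      forall x : TT TS, ell_zero (thetaM (TF H x)) = H (ellT x) &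
      forall x : TT TS, zero_lam (thetaM (TF H x)) = H (TF lamM (flipT x))].

Definition vertical (K : SA -> TS) : Prop :=
  [/\ is_alg_map K,
      forall v : SA, lamM (K v) = v,
      forall a : RA, K (sq a) = tI (sq a),
      forall x : TS, ellT (TF K x) = K (lamM x) &
      forall x : TS, TF lamM (flipT (TF K x)) = K (lamM x)].

Definition tc_connection (K : SA -> TS) (H : TS -> TAS) : Prop :=
  [/\ vertical K, horizontal H,
      forall v : SA, H (K v) = tAS 1 (sq (zM v)) &
      forall m : M, K (sm m) + UM (H (tD (sm m))) = tD (sm m)].

Definition H_of (nab : M -> TAS) : TS -> TAS :=
  @the_map R TS TAS (fun f => [/\ is_alg_map f,
                        forall a, f (tI (sq a)) = tAS (tI a) 1,
                        forall m, f (tI (sm m)) = tAS 1 (sm m),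
                        forall a, f (tD (sq a)) = tAS (tD a) 1 &
                        forall m, f (tD (sm m)) = nab m]).
Definition K_of (nab : M -> TAS) : SA -> TS :=
  @the_map R SA TS (fun f => [/\ is_alg_map f,
                        forall a, f (sq a) = tI (sq a) &
                        forall m, f (sm m) = tD (sm m) - UM (nab m)]).

Definition nabla_of (H : TS -> TAS) : M -> TAS := fun m => H (tD (sm m)).

End Bundle.

(* Main.v *)
Require Import Defs.
From HB Require Import structures.
From mathcomp Require Import all_boot all_order all_algebra.
From mathcomp Require Import generic_quotient ring_quotient finmap monalg.
From Stdlib Require Import ClassicalEpsilon.
Set Implicit Arguments. Unset Strict Implicit. Unset Printing Implicit Defensive.
Import GRing.Theory.
Local Open Scope ring_scope.
Local Open Scope quotient_scope.

(* T(B), S_A(M) and the tensor products enter only through their universal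
   properties; derivations are handled as algebra maps into dual numbers. Every
   structure map is then determined by its values on generators, and the axioms
   of (K_nabla, H_nabla) are checked there, writing nabla(m) as a sum of terms
   d(a) (x) m'. Conversely, (H3) and (H4) at d'd(m) say that H(d m) is fixed by
   the projections of T(A) (x) S_A(M) to degree one in T(A) and in S_A(M), so
   H(d m) lies in Omega(A) (x) M; the Leibniz rule comes from that of d. *)

(** A map chosen by [the_map] has no known property until some map meets its specification, so every
    structure map costs an existence proof. An [ralg] may carry any function as [ralg_s], so lifting
    into one asks for [scalar_hom]. No grading is ever built. The composite of [ell] with d' is a
    derivation of T(A) along a map that kills every d(a); it sends a to 0 and d(a) to d(a), and by
    the Leibniz rule it kills products of two differentials. Hence it acts as the projection to
    degree one. The composite of [lam] with d plays the same role on S_A(M). *)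

Definition scalar_hom (R : comNzRingType) (C : ralg R) : Prop :=
  [/\ forall x y, ralg_s C (x + y) = ralg_s C x + ralg_s C y,
      forall x y, ralg_s C (x * y) = ralg_s C x * ralg_s C y &
      ralg_s C 1 = 1].

(** * Evaluation of polynomials at elements of an algebra *)

Section Evaluation.
Variables (R : comNzRingType) (X : choiceType) (C : ralg R).
Variables (hC : scalar_hom C) (g : X -> C).

Definition monom_eval (m : {cmonom X}) : C := \prod_(i <- finsupp m) g i ^+ m i.

Definition free_eval (p : FreeR R X) : C :=
  \sum_(k <- msupp p) ralg_s C p@_k * monom_eval k.

Lemma scalar_hom0 : ralg_s C 0 = 0.
Proof. by case: hC => sD _ _; apply: (addIr (ralg_s C 0)); rewrite -sD !add0r. Qed.

(** Exponents vanish off the support, so the index set may grow. Two monomials can then be evaluated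
    over one common set, as multiplicativity requires; [free_evalEw] does the same for sums. *)
Lemma monom_evalEw (m : {cmonom X}) (d : {fset X}) :
  (finsupp m `<=` d)%fset -> monom_eval m = \prod_(i <- d) g i ^+ m i.
Proof.
move=> le; rewrite /monom_eval (big_fset_incl _ le) //.
by move=> i _; rewrite -cmE_neq0 negbK => /eqP ->; rewrite expr0.
Qed.

Lemma monom_evalM (m1 m2 : {cmonom X}) :
  monom_eval (mmul m1 m2) = monom_eval m1 * monom_eval m2.
Proof.
rewrite /monom_eval mdomD -/(monom_eval m1) -/(monom_eval m2).
rewrite (monom_evalEw (fsubsetUl _ (finsupp m2))).
rewrite (monom_evalEw (fsubsetUr (finsupp m1) _)) -big_split /=.
by apply: eq_bigr => i _; rewrite cmM exprD.
Qed.

Lemma monom_eval1 : monom_eval mone = 1.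
Proof. by rewrite /monom_eval mdom1 big_seq_fset0. Qed.

Lemma free_evalEw (d : {fset {cmonom X}}) (p : FreeR R X) :
  (msupp p `<=` d)%fset -> free_eval p = \sum_(k <- d) ralg_s C p@_k * monom_eval k.
Proof.
move=> le; rewrite [LHS](big_fset_incl _ le) => //= x xd /mcoeff_outdom ->.
by rewrite scalar_hom0 mul0r.
Qed.

Lemma free_evalD p q : free_eval (p + q) = free_eval p + free_eval q.
Proof.
rewrite (free_evalEw (msuppD_le p q)).
rewrite (free_evalEw (fsubsetUl (msupp p) (msupp q))).
rewrite (free_evalEw (fsubsetUr (msupp p) (msupp q))) -big_split /=.
by apply: eq_bigr => k _; rewrite mcoeffD; case: hC => -> _ _; rewrite mulrDl.
Qed.

Lemma free_eval0 : free_eval 0 = 0.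
Proof. by rewrite /free_eval msupp0 big_seq_fset0. Qed.

Lemma free_evalN p : free_eval (- p) = - free_eval p.
Proof. by apply: (addIr (free_eval p)); rewrite -free_evalD !addNr free_eval0. Qed.

Lemma free_evalB p q : free_eval (p - q) = free_eval p - free_eval q.
Proof. by rewrite free_evalD free_evalN. Qed.

Lemma free_eval_sum (I : Type) (r : seq I) (F : I -> FreeR R X) :
  free_eval (\sum_(i <- r) F i) = \sum_(i <- r) free_eval (F i).
Proof. exact: (big_morph free_eval free_evalD free_eval0). Qed.

Lemma free_evalU c m : free_eval << c *g m >> = ralg_s C c * monom_eval m.
Proof. by rewrite (free_evalEw msuppU_le) big_seq_fset1 mcoeffUU. Qed.

Lemma free_evalM p q : free_eval (p * q) = free_eval p * free_eval q.
Proof.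
rewrite malgME free_eval_sum mulr_suml; apply: eq_bigr => i _.
rewrite free_eval_sum mulr_sumr; apply: eq_bigr => j _.
by rewrite free_evalU monom_evalM; case: hC => _ -> _; rewrite mulrACA.
Qed.

Lemma free_evalC r : free_eval (r%:A) = ralg_s C r.
Proof. by rewrite -mul_malgC mulr1 free_evalU monom_eval1 mulr1. Qed.

Lemma free_eval1 : free_eval 1 = 1.
Proof. by rewrite -[1]scale1r free_evalC; case: hC. Qed.

Lemma free_eval_gen x : free_eval (fgen R x) = g x.
Proof.
rewrite free_evalU /monom_eval mdomU big_seq_fset1 cmUU expr1.
by case: hC => _ _ ->; rewrite mul1r.
Qed.

(** From here on there is one evaluation lemma for each shape of defining relation: additive,
    multiplicative, identification with a given polynomial, Leibniz. *)
Lemma free_eval_addition x y z :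
  free_eval (fgen R x - fgen R y - fgen R z) = g x - g y - g z.
Proof.
rewrite -(free_eval_gen x) -(free_eval_gen y) -(free_eval_gen z).
by move: (fgen R x) (fgen R y) (fgen R z) => p q r; rewrite !free_evalB.
Qed.

Lemma free_eval_product x y z :
  free_eval (fgen R x - fgen R y * fgen R z) = g x - g y * g z.
Proof.
rewrite -(free_eval_gen x) -(free_eval_gen y) -(free_eval_gen z).
move: (fgen R x) (fgen R y) (fgen R z) => p q r.
by rewrite free_evalB free_evalM.
Qed.

Lemma free_eval_subr x p : free_eval (fgen R x - p) = g x - free_eval p.
Proof. by rewrite -(free_eval_gen x); move: (fgen R x) => q; rewrite free_evalB. Qed.

Lemma free_eval_leibniz x y z t u :
  free_eval (fgen R x - fgen R y * fgen R z - fgen R t * fgen R u)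
  = g x - g y * g z - g t * g u.
Proof.
rewrite -free_eval_product -(free_eval_gen t) -(free_eval_gen u).
move: (fgen R x - _) (fgen R t) (fgen R u) => p q r.
by rewrite free_evalB free_evalM.
Qed.
End Evaluation.

(** * Induction on polynomials *)

Section FreeInduction.
Variables (R : comNzRingType) (X : choiceType) (P : FreeR R X -> Prop).
Hypotheses (PC : forall r : R, P r%:A) (Pg : forall x, P (fgen R x)).
Hypotheses (PD : forall p q, P p -> P q -> P (p + q)).
Hypotheses (PM : forall p q, P p -> P q -> P (p * q)).

Lemma monom_ind (m : {cmonom X}) : P << m >>.
Proof.
have [n] := ubnP (mdeg m); elim: n m => // n IHn m.
have [->|/eqP m1] := eqVneq m mone; first by move: (PC 1); rewrite scale1r.
have [i hi] : exists i, i \in finsupp m.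
  case: (fset_0Vmem (finsupp m)) => [h|[i hi]]; last by exists i.
  by case: m1; apply: mdeg_eq0I; rewrite mdegE h big_seq_fset0.
(* Strong induction on the degree: one variable of the support is split off. Truncated subtraction
   of exponents is harmless because the exponent at [i] is positive. *)
have mi : m = mmul (ucm i) (divcm m (ucm i)).
  apply/eqP/cmP => j; rewrite cmM divcmE cmU.
  have [<-|_] := eqVneq i j; last by rewrite subn0.
  by rewrite subnKC // lt0n cmE_neq0.
rewrite {1}mi mdegM mdegU ltnS => lt.
have -> : << m >> = fgen R i * << divcm m (ucm i) >> :> FreeR R X.
  by rewrite {1}mi malgM_def fgmulUU mulr1.
by apply: PM => //; apply: IHn.
Qed.

Lemma free_ind (p : FreeR R X) : P p.
Proof.
rewrite [p]monalgE; apply: big_ind => // [|k _].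
  by move: (PC 0); rewrite scale0r.
have hU c : P << c *g k >>.
  have -> : << c *g k >> = << c *g mone >> * << k >> :> FreeR R X.
    by rewrite malgM_def fgmulUU mulr1 mul1m.
  apply: PM; last exact: monom_ind.
  by move: (PC c); rewrite -mul_malgC mulr1.
exact: hU.
Qed.
End FreeInduction.

(** * Presented algebras: relations, induction, universal property *)

Section Presentations.
Variables (R : comNzRingType) (X : choiceType) (rels : FreeR R X -> Prop).

Lemma ppiD p q : ppi rels (p + q) = ppi rels p + ppi rels q.
Proof. by rewrite /ppi !piE. Qed.
Lemma ppiM p q : ppi rels (p * q) = ppi rels p * ppi rels q.
Proof. by rewrite /ppi !piE. Qed.
Lemma ppi1 : ppi rels 1 = 1.
Proof. by rewrite /ppi !piE. Qed.
Lemma ppi0 : ppi rels 0 = 0.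
Proof. by rewrite /ppi !piE. Qed.
Lemma ppiB p q : ppi rels (p - q) = ppi rels p - ppi rels q.
Proof. by rewrite /ppi !piE. Qed.

Lemma pres_scalar_hom : scalar_hom (PresAlg rels).
Proof.
split=> [x y|x y|] /=; rewrite -?ppiD -?ppiM ?scale1r ?ppi1 ?scalerDl //.
by rewrite -scalerAl mul1r scalerA.
Qed.

Lemma pres_rel p : rels p -> ppi rels p = 0.
Proof.
move=> hp; rewrite -ppi0; apply/eqP; rewrite /ppi piE Quotient.equivE subr0.
apply/asbP; exists [:: (1, p)]; split; last by rewrite big_seq1 mul1r.
by move=> c; rewrite inE => /eqP ->.
Qed.

Lemma pres_rel_sub p q : rels (p - q) -> ppi rels p = ppi rels q.
Proof. by move/pres_rel; rewrite ppiB => /eqP; rewrite subr_eq0 => /eqP. Qed.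

Lemma pres_rel_sub2 p q r : rels (p - q - r) -> ppi rels p = ppi rels q + ppi rels r.
Proof. by rewrite -addrA -opprD => /pres_rel_sub; rewrite ppiD. Qed.

(** This lemma and the next ones turn each shape of relation into an equation between generators,
    dual to the evaluation lemmas above. *)
Lemma pres_rel_gen x : rels (fgen R x) -> pgen rels x = 0.
Proof. exact: pres_rel. Qed.

Lemma pres_rel_gens x y : rels (fgen R x - fgen R y) -> pgen rels x = pgen rels y.
Proof. exact: pres_rel_sub. Qed.

Lemma pres_rel_addition x y z : rels (fgen R x - fgen R y - fgen R z) ->
  pgen rels x = pgen rels y + pgen rels z.
Proof. exact: pres_rel_sub2. Qed.

Lemma pres_rel_product x y z : rels (fgen R x - fgen R y * fgen R z) ->
  pgen rels x = pgen rels y * pgen rels z.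
Proof. by move/pres_rel_sub => h; rewrite [LHS]h; apply: ppiM. Qed.

Lemma pres_rel_one x : rels (fgen R x - 1) -> pgen rels x = 1.
Proof. by move/pres_rel_sub => h; rewrite [LHS]h ppi1. Qed.

Lemma pres_rel_scalar x r :
  rels (fgen R x - r%:A) -> pgen rels x = ralg_s (PresAlg rels) r.
Proof. exact: pres_rel_sub. Qed.

Lemma pres_rel_leibniz x y z t u :
    rels (fgen R x - fgen R y * fgen R z - fgen R t * fgen R u) ->
  pgen rels x = pgen rels y * pgen rels z + pgen rels t * pgen rels u.
Proof. by move/pres_rel_sub2 => h; rewrite [LHS]h; congr (_ + _); apply: ppiM. Qed.

Lemma pres_ind (P : PresAlg rels -> Prop) :
    (forall r, P (ralg_s _ r)) -> (forall x, P (pgen rels x)) ->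
    (forall u v, P u -> P v -> P (u + v)) ->
    (forall u v, P u -> P v -> P (u * v)) -> forall u, P u.
Proof.
move=> PC Pg PD PM u; rewrite -[u]reprK; elim/free_ind: (repr u) => //.
- by move=> p q hp hq; move: (PD _ _ hp hq); rewrite -ppiD.
- by move=> p q hp hq; move: (PM _ _ hp hq); rewrite -ppiM.
Qed.

Lemma pres_lift (C : ralg R) (g : X -> C) : scalar_hom C ->
    (forall p, rels p -> free_eval g p = 0) ->
  exists2 f : PresAlg rels -> C, is_alg_map f & forall x, f (pgen rels x) = g x.
Proof.
move=> hC hg; pose f (u : PresAlg rels) := free_eval g (repr u).
(* The value does not depend on the representative: two of them differ by a combination of
   relations, and each relation evaluates to 0. *)
have fpi p : f (ppi rels p) = free_eval g p.
  apply/eqP; rewrite -subr_eq0 -free_evalB //; apply/eqP.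
  have : repr (ppi rels p) - p \in idealb rels.
    by rewrite Quotient.idealrBE /ppi reprK.
  move=> /asbP [s [hs ->]]; rewrite free_eval_sum // big_seq big1 // => c cs.
  by rewrite free_evalM // (hg _ (hs _ cs)) mulr0.
exists f; last by move=> x; rewrite fpi free_eval_gen.
split.
- by move=> x y; rewrite -[x]reprK -[y]reprK -ppiD !fpi free_evalD.
- by move=> x y; rewrite -[x]reprK -[y]reprK -ppiM !fpi free_evalM.
- by rewrite -ppi1 fpi free_eval1.
- by move=> r; rewrite fpi free_evalC.
Qed.
End Presentations.

(** The only access to a map defined by [the_map]: epsilon obeys its specification once that is
    known to be satisfiable. *)
Lemma the_mapP (R : comNzRingType) (B C : ralg R) (P : (B -> C) -> Prop) :
  (exists f, P f) -> P (the_map P).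
Proof. exact: epsilon_spec. Qed.

(** * Algebra maps and derivations along them *)

Definition is_der (R : comNzRingType) (B C : ralg R) (f d : B -> C) : Prop :=
  [/\ forall x y, d (x + y) = d x + d y,
      forall x y, d (x * y) = f x * d y + f y * d x &
      forall r, d (ralg_s B r) = 0].

Section AlgebraMaps.
Variables (R : comNzRingType) (B C : ralg R) (f : B -> C).
Hypothesis hf : is_alg_map f.

Lemma alg_mapD x y : f (x + y) = f x + f y. Proof. by case: hf. Qed.
Lemma alg_mapM x y : f (x * y) = f x * f y. Proof. by case: hf. Qed.
Lemma alg_map1 : f 1 = 1. Proof. by case: hf. Qed.
Lemma alg_mapS r : f (ralg_s B r) = ralg_s C r. Proof. by case: hf. Qed.
Lemma alg_map0 : f 0 = 0.
Proof. by apply: (addIr (f 0)); rewrite -alg_mapD !add0r. Qed.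
Lemma alg_mapN x : f (- x) = - f x.
Proof. by apply: (addIr (f x)); rewrite -alg_mapD !addNr alg_map0. Qed.
Lemma alg_map_sum (I : Type) (r : seq I) (F : I -> B) :
  f (\sum_(i <- r) F i) = \sum_(i <- r) f (F i).
Proof. exact: (big_morph f alg_mapD alg_map0). Qed.

Variable d : B -> C.
Hypothesis hd : is_der f d.

Lemma derD x y : d (x + y) = d x + d y. Proof. by case: hd. Qed.
Lemma derM x y : d (x * y) = f x * d y + f y * d x. Proof. by case: hd. Qed.
Lemma derS r : d (ralg_s B r) = 0. Proof. by case: hd. Qed.
Lemma der0 : d 0 = 0.
Proof. by apply: (addIr (d 0)); rewrite -derD !add0r. Qed.
Lemma derN x : d (- x) = - d x.
Proof. by apply: (addIr (d x)); rewrite -derD !addNr der0. Qed.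
Lemma der1 : d 1 = 0.
Proof.
by apply: (addIr (d 1)); rewrite add0r -{3}[1]mulr1 derM alg_map1 !mul1r.
Qed.
Lemma der_sum (I : Type) (r : seq I) (F : I -> B) :
  d (\sum_(i <- r) F i) = \sum_(i <- r) d (F i).
Proof. exact: (big_morph d derD der0). Qed.
End AlgebraMaps.

Lemma alg_map_id (R : comNzRingType) (B : ralg R) : is_alg_map (fun x : B => x).
Proof. by []. Qed.

Lemma alg_map_comp (R : comNzRingType) (B C D : ralg R) (g : C -> D) (f : B -> C) :
  is_alg_map g -> is_alg_map f -> is_alg_map (fun x => g (f x)).
Proof.
move=> hg hf; split=> *.
- by rewrite (alg_mapD hf) (alg_mapD hg).
- by rewrite (alg_mapM hf) (alg_mapM hg).
- by rewrite (alg_map1 hf) (alg_map1 hg).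
- by rewrite (alg_mapS hf) (alg_mapS hg).
Qed.

Lemma der_comp (R : comNzRingType) (B C D : ralg R) (f d : C -> D) (g : B -> C) :
  is_der f d -> is_alg_map g -> is_der (fun x => f (g x)) (fun x => d (g x)).
Proof.
move=> hd hg; split=> *.
- by rewrite (alg_mapD hg) (derD hd).
- by rewrite (alg_mapM hg) (derM hd).
- by rewrite (alg_mapS hg) (derS hd).
Qed.

Lemma comp_der (R : comNzRingType) (B C D : ralg R) (f d : B -> C) (g : C -> D) :
  is_alg_map g -> is_der f d -> is_der (fun x => g (f x)) (fun x => g (d x)).
Proof.
move=> hg hd; split=> *.
- by rewrite (derD hd) (alg_mapD hg).
- by rewrite (derM hd) (alg_mapD hg) !(alg_mapM hg).
- by rewrite (derS hd) (alg_map0 hg).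
Qed.

(** Serves the structure maps that send a whole family of differentials to 0, such as [zeroT],
    [ellT] and [lamM]. *)
Lemma der_cst0 (R : comNzRingType) (B C : ralg R) (f : B -> C) :
  is_der f (fun=> 0).
Proof. by split=> *; rewrite ?mulr0 ?addr0. Qed.

(* [dual C] is C[e]/(e^2): an algebra map into it is an algebra map f into C
   together with an f-derivation, so derivations out of a presented algebra
   come from the same universal property as algebra maps. *)
Definition dual (C : comPzRingType) : Type := (C * C)%type.

Section Dual.
Variable C : comPzRingType.
HB.instance Definition _ := GRing.Zmodule.copy (dual C) (C * C)%type.

Definition dual_one : dual C := (1, 0).
Definition dual_mul (x y : dual C) : dual C := (x.1 * y.1, x.1 * y.2 + y.1 * x.2).

Lemma dual_mulA : associative dual_mul.
Proof.
move=> [x x'] [y y'] [z z']; rewrite /dual_mul /=; congr (_, _); first by rewrite mulrA.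
by rewrite !mulrDr !mulrA addrA [z * x]mulrC [z * y]mulrC.
Qed.
Lemma dual_mulC : commutative dual_mul.
Proof.
by move=> [x x'] [y y']; rewrite /dual_mul /= [x * y]mulrC [y * x' + _]addrC.
Qed.
Lemma dual_mul1 : left_id dual_one dual_mul.
Proof. by move=> [x x']; rewrite /dual_mul /= !mul1r mulr0 addr0. Qed.
Lemma dual_mulDl : left_distributive dual_mul +%R.
Proof.
move=> [x x'] [y y'] [z z']; rewrite /dual_mul /=; congr (_, _); rewrite mulrDl //.
by rewrite mulrDr addrACA.
Qed.
HB.instance Definition _ := GRing.Zmodule_isComPzRing.Build (dual C)
  dual_mulA dual_mulC dual_mul1 dual_mulDl.
End Dual.

Definition dual_alg (R : comNzRingType) (C : ralg R) : ralg R :=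
  @RAlg R (dual C) (fun r => (ralg_s C r, 0)).

Section DualAlg.
Variables (R : comNzRingType) (B C : ralg R).

Lemma dual_scalar_hom : scalar_hom C -> scalar_hom (dual_alg C).
Proof.
case=> sD sM s1; split=> [x y|x y|] /=.
- by rewrite sD; congr (_, _); rewrite addr0.
- by rewrite sM; congr (_, _); rewrite /= !mulr0 addr0.
- by rewrite s1.
Qed.

Lemma dual_alg_map (f d : B -> C) : is_alg_map f -> is_der f d ->
  is_alg_map (fun x => (f x, d x) : dual_alg C).
Proof.
move=> hf hd; split=> *.
- by rewrite (alg_mapD hf) (derD hd).
- by rewrite (alg_mapM hf) (derM hd).
- by rewrite (alg_map1 hf) (der1 hf hd).
- by rewrite (alg_mapS hf) (derS hd).
Qed.

Lemma dual_alg_map_fst (F : B -> dual_alg C) :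
  is_alg_map F -> is_alg_map (fun x => (F x).1).
Proof.
move=> hF; split=> *.
- by rewrite (alg_mapD hF).
- by rewrite (alg_mapM hF).
- by rewrite (alg_map1 hF).
- by rewrite (alg_mapS hF).
Qed.

Lemma dual_alg_map_snd (F : B -> dual_alg C) :
  is_alg_map F -> is_der (fun x => (F x).1) (fun x => (F x).2).
Proof.
move=> hF; split=> *.
- by rewrite (alg_mapD hF).
- by rewrite (alg_mapM hF).
- by rewrite (alg_mapS hF).
Qed.
End DualAlg.

(** * Relations expressing that a map into the generators is an algebra map *)

Section HomRels.
Variables (R : comNzRingType) (C : ralg R) (X : choiceType) (j : C -> X).

Lemma hom_rels_eval (D : ralg R) (g : X -> D) p : scalar_hom D ->
  is_alg_map (fun c => g (j c)) -> hom_rels j p -> free_eval g p = 0.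
Proof.
move=> hD hf.
case=> [[b [b' ->]]|[b [b' ->]]|->|[r ->]].
- by rewrite free_eval_addition // (alg_mapD hf) addrAC addrK subrr.
- by rewrite free_eval_product // (alg_mapM hf) subrr.
- by rewrite free_eval_subr // free_eval1 // (alg_map1 hf) subrr.
- by rewrite free_eval_subr // free_evalC // (alg_mapS hf) subrr.
Qed.

Lemma hom_rels_map (rels : FreeR R X -> Prop) :
  (forall p, hom_rels j p -> rels p) -> is_alg_map (fun c => pgen rels (j c)).
Proof.
move=> h; split.
- by move=> x y; apply/pres_rel_addition/h; constructor 1; exists x, y.
- by move=> x y; apply/pres_rel_product/h; constructor 2; exists x, y.
- by apply/pres_rel_one/h; constructor 3.
- by move=> r; apply/pres_rel_scalar/h; constructor 4; exists r.
Qed.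
End HomRels.

(** * Universal properties of T(B), the symmetric algebra and the tensor product *)

Record tangent_theory (R : comNzRingType) := TangentTheory {
  tgT :> ralg R -> ralg R;
  tgI : forall B : ralg R, B -> tgT B;
  tgD : forall B : ralg R, B -> tgT B;
  tg_scalar : forall B, scalar_hom (tgT B);
  tgI_map : forall B : ralg R, is_alg_map (@tgI B);
  tgD_der : forall B : ralg R, is_der (@tgI B) (@tgD B);
  tg_ind : forall B (P : tgT B -> Prop), (forall r, P (ralg_s _ r)) ->
    (forall b, P (tgI b)) -> (forall b, P (tgD b)) ->
    (forall u v, P u -> P v -> P (u + v)) ->
    (forall u v, P u -> P v -> P (u * v)) -> forall u, P u;
  tg_lift : forall (B C : ralg R) (f d : B -> C), scalar_hom C ->
    is_alg_map f -> is_der f d -> exists F : tgT B -> C,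
    [/\ is_alg_map F, forall b, F (tgI b) = f b & forall b, F (tgD b) = d b] }.

(** As in [tangent_theory], uniqueness of lifts is stated as an induction principle, because
    induction also bounds the image of a map, as in [lam_D_sym]. Scalars need no case of their own:
    they come from [A] through [syq]. *)
Record sym_theory (R : comNzRingType) (A : comAlgType R) (M : lmodType A) := SymTheory {
  syS :> ralg R;
  syq : RA A -> syS;
  sym : M -> syS;
  sy_scalar : scalar_hom syS;
  syq_map : is_alg_map syq;
  symD : forall m m', sym (m + m') = sym m + sym m';
  symZ : forall (a : A) m, sym (a *: m) = syq a * sym m;
  sy_ind : forall P : syS -> Prop, (forall a, P (syq a)) -> (forall m, P (sym m)) ->
    (forall u v, P u -> P v -> P (u + v)) ->
    (forall u v, P u -> P v -> P (u * v)) -> forall u, P u;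
  sy_lift : forall (C : ralg R) (f : RA A -> C) (mu : M -> C), scalar_hom C ->
    is_alg_map f -> (forall m m', mu (m + m') = mu m + mu m') ->
    (forall (a : A) m, mu (a *: m) = f a * mu m) ->
    exists F : syS -> C, [/\ is_alg_map F, forall a, F (syq a) = f a &
                              forall m, F (sym m) = mu m] }.

(** [te_sum] has two uses: it gives uniqueness of maps out of the tensor product, and it decomposes
    H(d m) in [horizontal_omega]. *)
Record tensor_theory (R : comNzRingType) (B C D : ralg R) (f : B -> C) (h : B -> D) :=
  TensorTheory {
  teP :> ralg R;
  tet : C -> D -> teP;
  te_scalar : scalar_hom teP;
  tel_map : is_alg_map (fun c => tet c 1);
  ter_map : is_alg_map (fun d => tet 1 d);
  teE : forall c d, tet c d = tet c 1 * tet 1 d;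
  te_base : forall b, tet (f b) 1 = tet 1 (h b);
  te_sum : forall x, exists s : seq (C * D), x = \sum_(p <- s) tet p.1 p.2;
  te_lift : forall (E : ralg R) (F : C -> E) (G : D -> E), scalar_hom E ->
    is_alg_map F -> is_alg_map G -> (forall b, F (f b) = G (h b)) ->
    exists L : teP -> E, is_alg_map L /\ forall c d, L (tet c d) = F c * G d }.

(** * The presented algebras have these universal properties *)

Section Concrete.
Variable R : comNzRingType.

Section Tangent.
Variable B : ralg R.

Lemma tI_alg_map : is_alg_map (@tI R B).
Proof. by apply: (@hom_rels_map _ _ _ (@inl B B)) => p; constructor 1. Qed.

Lemma tD_der : is_der (@tI R B) (@tD R B).
Proof.
split.
- by move=> x y; apply: pres_rel_addition; constructor 2; exists x, y.
- by move=> x y; apply: pres_rel_leibniz; constructor 3; exists x, y.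
- by move=> r; apply: pres_rel_gen; constructor 4; exists r.
Qed.

Lemma TT_ind (P : TT B -> Prop) : (forall r, P (ralg_s _ r)) ->
  (forall b, P (tI b)) -> (forall b, P (tD b)) ->
  (forall u v, P u -> P v -> P (u + v)) ->
  (forall u v, P u -> P v -> P (u * v)) -> forall u, P u.
Proof.
move=> PC PI PD Pa Pm; apply: (@pres_ind _ _ (@T_rels R B) P PC _ Pa Pm).
by case; [exact: PI|exact: PD].
Qed.

Lemma TT_lift (C : ralg R) (f d : B -> C) : scalar_hom C ->
    is_alg_map f -> is_der f d ->
  exists F : TT B -> C, [/\ is_alg_map F, forall b, F (tI b) = f b &
                            forall b, F (tD b) = d b].
Proof.
move=> hC hf hd.
pose g (x : B + B) := match x with inl b => f b | inr b => d b end.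
have [|F hF Fg] := @pres_lift _ _ (@T_rels R B) C g hC.
  move=> p; case=> [|[b [b' ->]]|[b [b' ->]]|[r ->]]; first exact: hom_rels_eval.
  - by rewrite free_eval_addition //= (derD hd) addrAC addrK subrr.
  - by rewrite free_eval_leibniz //= (derM hd) addrAC addrK subrr.
  - by rewrite free_eval_gen //= (derS hd).
exists F; split; first exact: hF.
- by move=> b; apply: Fg.
- by move=> b; apply: Fg.
Qed.
End Tangent.

Definition TT_theory : tangent_theory R :=
  TangentTheory (fun B => pres_scalar_hom (@T_rels R B)) tI_alg_map tD_der TT_ind TT_lift.

Section Symmetric.
Variables (A : comAlgType R) (M : lmodType A).

Lemma sq_alg_map : is_alg_map (@sq R A M).
Proof. by apply: (@hom_rels_map _ (RA A) _ inl) => p; constructor 1. Qed.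

Lemma smD m m' : sm (m + m') = sm m + sm m' :> SA M.
Proof. by apply: pres_rel_addition; constructor 2; exists m, m'. Qed.

Lemma smZ (a : A) m : sm (a *: m) = sq M a * sm m.
Proof. by apply: pres_rel_product; constructor 3; exists a, m. Qed.

Lemma SA_ind (P : SA M -> Prop) : (forall a, P (sq M a)) -> (forall m, P (sm m)) ->
  (forall u v, P u -> P v -> P (u + v)) ->
  (forall u v, P u -> P v -> P (u * v)) -> forall u, P u.
Proof.
move=> Pq Pm PD PM; apply: (@pres_ind _ _ (@S_rels R A M) P _ _ PD PM).
  by move=> r; rewrite -(alg_mapS sq_alg_map r); apply: Pq.
by case; [exact: Pq|exact: Pm].
Qed.

Lemma SA_lift (C : ralg R) (f : RA A -> C) (mu : M -> C) : scalar_hom C ->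
    is_alg_map f -> (forall m m', mu (m + m') = mu m + mu m') ->
    (forall (a : A) m, mu (a *: m) = f a * mu m) ->
  exists F : SA M -> C, [/\ is_alg_map F, forall a, F (sq M a) = f a &
                            forall m, F (sm m) = mu m].
Proof.
move=> hC hf muD muZ.
pose g (x : A + M) : C := match x with inl a => f a | inr m => mu m end.
have [|F hF Fg] := @pres_lift _ _ (@S_rels R A M) C g hC.
  move=> p; case=> [|[m [m' ->]]|[a [m ->]]].
  - exact: hom_rels_eval.
  - by rewrite free_eval_addition //= muD addrAC addrK subrr.
  - by rewrite free_eval_product //= muZ subrr.
exists F; split; first exact: hF.
- by move=> a; apply: Fg.
- by move=> m; apply: Fg.
Qed.

Definition SA_theory : sym_theory M :=
  SymTheory (pres_scalar_hom (@S_rels R A M)) sq_alg_map smD smZ SA_ind SA_lift.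
End Symmetric.

Section Tensor.
Variables (B C D : ralg R) (f : B -> C) (h : B -> D).

Lemma tens_inl_map : is_alg_map (fun c => pgen (Tens_rels f h) (inl c)).
Proof. by apply: hom_rels_map => p; constructor 1. Qed.
Lemma tens_inr_map : is_alg_map (fun d => pgen (Tens_rels f h) (inr d)).
Proof. by apply: hom_rels_map => p; constructor 2. Qed.

Lemma tens_inl c : tens f h c 1 = pgen (Tens_rels f h) (inl c).
Proof. by rewrite /tens (alg_map1 tens_inr_map) mulr1. Qed.
Lemma tens_inr d : tens f h 1 d = pgen (Tens_rels f h) (inr d).
Proof. by rewrite /tens (alg_map1 tens_inl_map) mul1r. Qed.
Lemma tensE c d : tens f h c d = tens f h c 1 * tens f h 1 d.
Proof. by rewrite tens_inl tens_inr. Qed.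

Lemma tensl_map : is_alg_map (fun c => tens f h c 1).
Proof.
split=> *; rewrite !tens_inl; [exact: (alg_mapD tens_inl_map)|
 exact: (alg_mapM tens_inl_map)|exact: (alg_map1 tens_inl_map)|
 exact: (alg_mapS tens_inl_map)].
Qed.
Lemma tensr_map : is_alg_map (fun d => tens f h 1 d).
Proof.
split=> *; rewrite !tens_inr; [exact: (alg_mapD tens_inr_map)|
 exact: (alg_mapM tens_inr_map)|exact: (alg_map1 tens_inr_map)|
 exact: (alg_mapS tens_inr_map)].
Qed.

Lemma tens_base b : tens f h (f b) 1 = tens f h 1 (h b).
Proof. by rewrite tens_inl tens_inr; apply: pres_rel_gens; constructor 3; exists b. Qed.

Lemma tens_lift (E : ralg R) (F : C -> E) (G : D -> E) : scalar_hom E ->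
    is_alg_map F -> is_alg_map G -> (forall b, F (f b) = G (h b)) ->
  exists L : Tens f h -> E,
    is_alg_map L /\ forall c d, L (tens f h c d) = F c * G d.
Proof.
move=> hE hF hG FG.
pose g (x : C + D) := match x with inl c => F c | inr d => G d end.
have [|L hL Lg] := @pres_lift _ _ (Tens_rels f h) E g hE.
  move=> p; case=> [||[b ->]]; try exact: hom_rels_eval.
  by rewrite free_eval_subr // free_eval_gen //= FG subrr.
exists L; split=> [|c d]; first exact: hL.
by rewrite [LHS](alg_mapM hL); congr (_ * _); apply: Lg.
Qed.

Lemma tens_sum (x : Tens f h) :
  exists s : seq (C * D), x = \sum_(p <- s) tens f h p.1 p.2.
Proof.
elim/pres_ind: x => [r|[c|d]|_ _ [s ->] [t ->]|_ _ [s ->] [t ->]].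
- by exists [:: (ralg_s C r, 1)]; rewrite big_seq1 (alg_mapS tensl_map).
- by exists [:: (c, 1)]; rewrite big_seq1 tens_inl.
- by exists [:: (1, d)]; rewrite big_seq1 tens_inr.
- by exists (s ++ t); rewrite big_cat.
(* Pure tensors multiply factorwise, so a product of two sums is a sum over pairs. *)
exists [seq (p.1 * q.1, p.2 * q.2) | p <- s, q <- t].
rewrite big_allpairs_dep /= mulr_suml; apply: eq_bigr => p _.
rewrite mulr_sumr; apply: eq_bigr => q _.
rewrite [RHS]tensE (alg_mapM tensl_map) (alg_mapM tensr_map).
by rewrite [RHS]mulrACA; congr (_ * _); apply: tensE.
Qed.

Definition Tens_theory : tensor_theory f h :=
  TensorTheory (pres_scalar_hom (Tens_rels f h)) tensl_map tensr_map tensE tens_base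
    tens_sum tens_lift.
End Tensor.
End Concrete.

(** * Structure maps of the tangent structure *)

Section TangentTheory.
Variables (R : comNzRingType) (X : tangent_theory R).
Local Notation I := (tgI X).
Local Notation D := (tgD X).

Lemma tg_ext (B C : ralg R) (f g : X B -> C) : is_alg_map f -> is_alg_map g ->
  (forall b, f (I b) = g (I b)) -> (forall b, f (D b) = g (D b)) -> f =1 g.
Proof.
move=> hf hg hI hD; elim/tg_ind => // [r|u v hu hv|u v hu hv].
- by rewrite (alg_mapS hf) (alg_mapS hg).
- by rewrite (alg_mapD hf) (alg_mapD hg) hu hv.
- by rewrite (alg_mapM hf) (alg_mapM hg) hu hv.
Qed.

Lemma tg_der_ext (B C : ralg R) (f g d e : X B -> C) :
    is_der f d -> is_der g e -> f =1 g ->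
  (forall b, d (I b) = e (I b)) -> (forall b, d (D b) = e (D b)) -> d =1 e.
Proof.
move=> hd he fg hI hD; elim/tg_ind => // [r|u v hu hv|u v hu hv].
- by rewrite (derS hd) (derS he).
- by rewrite (derD hd) (derD he) hu hv.
- by rewrite (derM hd) (derM he) hu hv !fg.
Qed.

(** The functions [f], [d], [d'], [e] are the values at b, d(b), d'(b), d'd(b). The product law for
    [e] is what d' makes of the Leibniz rule of d. The universal property is used twice: T(B) is
    lifted to the dual numbers, and the resulting map with its derivation is lifted to T(T(B)). *)
Lemma tg2_lift (B C : ralg R) (f d d' e : B -> C) : scalar_hom C ->
    is_alg_map f -> is_der f d -> is_der f d' ->
    (forall x y, e (x + y) = e x + e y) ->
    (forall x y, e (x * y) = f x * e y + d y * d' x + (f y * e x + d x * d' y)) ->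
    (forall r, e (ralg_s B r) = 0) ->
  exists F : X (X B) -> C, [/\ is_alg_map F,
    forall b, F (I (I b)) = f b, forall b, F (I (D b)) = d b,
    forall b, F (D (I b)) = d' b & forall b, F (D (D b)) = e b].
Proof.
move=> hC hf hd hd' eD eM eS.
have [||G [hG GI GD]] := @tg_lift _ X B (dual_alg C) (fun b => (f b, d' b))
  (fun b => (d b, e b)) (dual_scalar_hom hC).
- exact: dual_alg_map.
- split=> [x y|x y|r].
  + by rewrite (derD hd) eD.
  + by rewrite (derM hd) eM.
  + by rewrite (derS hd) eS.
have [F [hF FI FD]] :=
  tg_lift X hC (dual_alg_map_fst hG) (dual_alg_map_snd hG).
exists F; split; first exact: hF.
- by move=> b; rewrite FI GI.
- by move=> b; rewrite FI GD.
- by move=> b; rewrite FD GI.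
- by move=> b; rewrite FD GD.
Qed.

Definition zero_spec (B : ralg R) (z : X B -> B) : Prop :=
  [/\ is_alg_map z, forall b, z (I b) = b & forall b, z (D b) = 0].
Definition TF_spec (B C : ralg R) (h : B -> C) (F : X B -> X C) : Prop :=
  [/\ is_alg_map F, forall b, F (I b) = I (h b) & forall b, F (D b) = D (h b)].
Definition ell_spec (B : ralg R) (l : X (X B) -> X B) : Prop :=
  [/\ is_alg_map l, forall b, l (I (I b)) = I b, forall b, l (I (D b)) = 0,
      forall b, l (D (I b)) = 0 & forall b, l (D (D b)) = D b].
Definition flip_spec (B : ralg R) (c : X (X B) -> X (X B)) : Prop :=
  [/\ is_alg_map c, forall b, c (I (I b)) = I (I b),
      forall b, c (I (D b)) = D (I b), forall b, c (D (I b)) = I (D b) &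
      forall b, c (D (D b)) = D (D b)].

Lemma zero_ex (B : ralg R) : scalar_hom B -> exists z, @zero_spec B z.
Proof.
move=> hB; have [z hz] := tg_lift X hB (alg_map_id B) (der_cst0 _).
by exists z.
Qed.

Lemma TF_ex (B C : ralg R) (h : B -> C) : is_alg_map h -> exists F, TF_spec h F.
Proof.
move=> hh; have [F hF] := tg_lift X (tg_scalar X C)
  (alg_map_comp (tgI_map X C) hh) (der_comp (tgD_der X C) hh).
by exists F.
Qed.

Lemma ell_ex (B : ralg R) : exists l, @ell_spec B l.
Proof.
have hD := tgD_der X B; have hI := tgI_map X B.
apply: (tg2_lift (tg_scalar X B) hI (der_cst0 _) (der_cst0 _)) => *.
- by rewrite (derD hD).
- by rewrite (derM hD) !mul0r !addr0.
- by rewrite (derS hD).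
Qed.

Lemma flip_ex (B : ralg R) : exists c, @flip_spec B c.
Proof.
have hD := tgD_der X B; have hD' := tgD_der X (X B).
have hI := tgI_map X B; have hI' := tgI_map X (X B).
apply: (tg2_lift (tg_scalar _ _) (alg_map_comp hI' hI)
  (der_comp hD' hI) (comp_der hI' hD)) => [x y|x y|r].
- by rewrite (derD hD) (derD hD').
- rewrite (derM hD) (derD hD') !(derM hD').
  (* The flip exchanges the two cross terms of the second-order Leibniz rule, so they are matched
     crosswise. *)
  by rewrite addrACA [RHS]addrACA [X in _ = _ + X]addrC; congr (_ + (_ + _)); apply: mulrC.
- by rewrite (derS hD) (der0 hD').
Qed.
End TangentTheory.

(** * Maps out of S_A(M), its tangent algebra and its second tangent algebra *)

Section SymTheory.
Variables (R : comNzRingType) (A : comAlgType R) (M : lmodType A).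
Variables (X : tangent_theory R) (Y : sym_theory M).
Local Notation I := (tgI X).
Local Notation D := (tgD X).
Local Notation q := (syq Y).
Local Notation s := (sym Y).

Lemma RA_scalar_hom : scalar_hom (RA A).
Proof.
split=> [x y|x y|] /=; rewrite ?scalerDl ?scale1r //.
by rewrite -scalerAl mul1r scalerA.
Qed.

Lemma sy_ext (C : ralg R) (f g : Y -> C) : is_alg_map f -> is_alg_map g ->
  (forall a, f (q a) = g (q a)) -> (forall m, f (s m) = g (s m)) -> f =1 g.
Proof.
move=> hf hg hq hm; elim/sy_ind => // u v hu hv.
- by rewrite (alg_mapD hf) (alg_mapD hg) hu hv.
- by rewrite (alg_mapM hf) (alg_mapM hg) hu hv.
Qed.

Lemma sy_der_ext (C : ralg R) (f g d e : Y -> C) :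
    is_der f d -> is_der g e -> f =1 g ->
  (forall a, d (q a) = e (q a)) -> (forall m, d (s m) = e (s m)) -> d =1 e.
Proof.
move=> hd he fg hq hm; elim/sy_ind => // u v hu hv.
- by rewrite (derD hd) (derD he) hu hv.
- by rewrite (derM hd) (derM he) hu hv !fg.
Qed.

Lemma tgsy_ext (C : ralg R) (f g : X Y -> C) : is_alg_map f -> is_alg_map g ->
    (forall a, f (I (q a)) = g (I (q a))) -> (forall m, f (I (s m)) = g (I (s m))) ->
    (forall a, f (D (q a)) = g (D (q a))) -> (forall m, f (D (s m)) = g (D (s m))) ->
  f =1 g.
Proof.
move=> hf hg h1 h2 h3 h4; have hI := tgI_map X Y; have hD := tgD_der X Y.
have hfI := sy_ext (alg_map_comp hf hI) (alg_map_comp hg hI) h1 h2.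
apply: (tg_ext hf hg hfI).
exact: (sy_der_ext (comp_der hf hD) (comp_der hg hD) hfI h3 h4).
Qed.

Lemma tg2sy_ext (C : ralg R) (f g : X (X Y) -> C) : is_alg_map f -> is_alg_map g ->
    (forall a, f (I (I (q a))) = g (I (I (q a)))) ->
    (forall m, f (I (I (s m))) = g (I (I (s m)))) ->
    (forall a, f (I (D (q a))) = g (I (D (q a)))) ->
    (forall m, f (I (D (s m))) = g (I (D (s m)))) ->
    (forall a, f (D (I (q a))) = g (D (I (q a)))) ->
    (forall m, f (D (I (s m))) = g (D (I (s m)))) ->
    (forall a, f (D (D (q a))) = g (D (D (q a)))) ->
    (forall m, f (D (D (s m))) = g (D (D (s m)))) -> f =1 g.
Proof.
move=> hf hg h1 h2 h3 h4 h5 h6 h7 h8.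
have hI := tgI_map X (X Y); have hD := tgD_der X (X Y).
have hfI := tgsy_ext (alg_map_comp hf hI) (alg_map_comp hg hI) h1 h2 h3 h4.
have hfD := comp_der hf hD; have hgD := comp_der hg hD.
have hI1 := tgI_map X Y; have hD1 := tgD_der X Y.
have hDI : forall u, f (D (I u)) = g (D (I u)).
  by apply: (sy_der_ext (der_comp hfD hI1) (der_comp hgD hI1)) => // u; apply: hfI.
apply: (tg_ext hf hg hfI); apply: (tg_der_ext hfD hgD hfI) => //.
(* The map u to d'd(u) is not a derivation, so [sy_der_ext] does not apply; the cross terms are
   settled by agreement on I(D u) and on D(I u). *)
elim/sy_ind => // u v hu hv.
- by rewrite (derD hD1) (derD hfD) (derD hgD) hu hv.
- rewrite (derM hD1) (derD hfD) (derD hgD) !(derM hfD) !(derM hgD).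
  by rewrite hu hv !hDI !hfI.
Qed.

(** The law imposed on [nu] is the Leibniz law of a module connection. It says exactly that the
    pairs ([mu], [nu]) are linear over A acting through ([f], [d]) on the dual numbers, which is how
    a connection becomes an algebra map. *)
Lemma tgsy_lift (C : ralg R) (f d : RA A -> C) (mu nu : M -> C) : scalar_hom C ->
    is_alg_map f -> is_der f d ->
    (forall m m', mu (m + m') = mu m + mu m') ->
    (forall (a : A) m, mu (a *: m) = f a * mu m) ->
    (forall m m', nu (m + m') = nu m + nu m') ->
    (forall (a : A) m, nu (a *: m) = f a * nu m + mu m * d a) ->
  exists F : X Y -> C, [/\ is_alg_map F,
    forall a, F (I (q a)) = f a, forall m, F (I (s m)) = mu m,
    forall a, F (D (q a)) = d a & forall m, F (D (s m)) = nu m].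
Proof.
move=> hC hf hd muD muZ nuD nuZ.
have [|||G [hG Gq Gm]] := @sy_lift _ _ _ Y (dual_alg C) (fun a => (f a, d a))
  (fun m => (mu m, nu m)) (dual_scalar_hom hC).
- exact: dual_alg_map.
- by move=> m m'; rewrite muD nuD.
- by move=> a m; rewrite muZ nuZ.
have [F [hF FI FD]] :=
  tg_lift X hC (dual_alg_map_fst hG) (dual_alg_map_snd hG).
exists F; split; first exact: hF.
- by move=> a; rewrite FI Gq.
- by move=> m; rewrite FI Gm.
- by move=> a; rewrite FD Gq.
- by move=> m; rewrite FD Gm.
Qed.

Definition z_spec (z : Y -> RA A) : Prop :=
  [/\ is_alg_map z, forall a, z (q a) = a & forall m, z (s m) = 0].
Definition lam_spec (l : X Y -> Y) : Prop :=
  [/\ is_alg_map l, forall a, l (I (q a)) = q a, forall m, l (I (s m)) = 0,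
      forall a, l (D (q a)) = 0 & forall m, l (D (s m)) = s m].

Lemma z_ex : exists z, z_spec z.
Proof.
have [||z hz] := sy_lift Y (mu := fun=> 0) RA_scalar_hom (alg_map_id _).
- by move=> *; rewrite addr0.
- by move=> *; rewrite mulr0.
by exists z.
Qed.

Lemma lam_ex : exists l, lam_spec l.
Proof.
apply: (tgsy_lift (mu := fun=> 0) (nu := s) (sy_scalar Y) (syq_map Y) (der_cst0 _)) => *.
- by rewrite addr0.
- by rewrite mulr0.
- exact: symD.
- by rewrite symZ mulr0 addr0.
Qed.
End SymTheory.

(** * Tensor products and the maps between them *)

Section TensorTheory.
Variables (R : comNzRingType) (B C D : ralg R) (f : B -> C) (h : B -> D).
Variable Z : tensor_theory f h.
Local Notation t := (tet Z).

Lemma te0l d : t 0 d = 0.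
Proof. by rewrite teE (alg_map0 (tel_map Z)) mul0r. Qed.
Lemma te0r c : t c 0 = 0.
Proof. by rewrite teE (alg_map0 (ter_map Z)) mulr0. Qed.

Lemma te_ext (E : ralg R) (F G : Z -> E) : is_alg_map F -> is_alg_map G ->
  (forall c d, F (t c d) = G (t c d)) -> F =1 G.
Proof.
move=> hF hG H x; have [s ->] := te_sum x.
by rewrite (alg_map_sum hF) (alg_map_sum hG); apply: eq_bigr.
Qed.
End TensorTheory.

Section BundleMaps.
Variables (R : comNzRingType) (A : comAlgType R) (M : lmodType A).
Variables (X : tangent_theory R) (Y : sym_theory M).
Variable (Z : tensor_theory (@tgI R X (RA A)) (syq Y)).
Local Notation I := (tgI X).
Local Notation D := (tgD X).
Local Notation q := (syq Y).
Local Notation s := (sym Y).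
Local Notation t := (tet Z).
Variables (Tp : X (RA A) -> X (X (RA A))) (Tq : X (RA A) -> X Y).
Hypotheses (hTp : TF_spec (@tgI R X (RA A)) Tp) (hTq : TF_spec (syq Y) Tq).
Variable W : tensor_theory Tp Tq.
Local Notation t2 := (tet W).

Definition U_spec (U : Z -> X Y) : Prop :=
  is_alg_map U /\ forall w v, U (t w v) = Tq w * I v.
Definition theta_spec (th : X Z -> W) : Prop :=
  [/\ is_alg_map th, forall w v, th (I (t w v)) = t2 (I w) (I v) &
      forall w v, th (D (t w v)) = t2 (D w) (I v) + t2 (I w) (D v)].
Definition fact_spec (F : X (X (RA A)) -> X (RA A)) (G : X Y -> Y) (L : W -> Z) : Prop :=
  is_alg_map L /\ forall x y, L (t2 x y) = t (F x) (G y).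

Lemma U_ex : exists U, U_spec U.
Proof.
have [hT TI _] := hTq.
by apply: (te_lift _ (tg_scalar X Y) hT (tgI_map X Y)) => b.
Qed.

Lemma theta_ex : exists th, theta_spec th.
Proof.
have [hp pI pD] := hTp; have [hq qI qD] := hTq.
have hl := tel_map W; have hr := ter_map W.
have [|||L [hL LE]] := @te_lift _ _ _ _ _ _ Z (dual_alg W)
  (fun w => (t2 (I w) 1, t2 (D w) 1)) (fun v => (t2 1 (I v), t2 1 (D v)))
  (dual_scalar_hom (te_scalar W)).
- apply: dual_alg_map; first exact: (alg_map_comp hl (tgI_map _ _)).
  exact: (comp_der hl (tgD_der _ _)).
- apply: dual_alg_map; first exact: (alg_map_comp hr (tgI_map _ _)).
  exact: (comp_der hr (tgD_der _ _)).
(* Compatibility over A has two components, which are the base relation of [W] at a and at d(a). *)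
- by move=> a; rewrite -pI -qI -pD -qD !te_base.
have [F [hF FI FD]] :=
  tg_lift X (te_scalar W) (dual_alg_map_fst hL) (dual_alg_map_snd hL).
exists F; split=> // w v; first by rewrite FI LE [RHS]teE.
by rewrite FD LE (teE W (D w) (I v)) (teE W (I w) (D v)) [RHS]addrC [X in _ = _ + X]mulrC.
Qed.

(** Covers both maps in (H3) and (H4). Each factor sends a to a and the differential coming from the
    base to 0, so the two composites agree on the generators of T(A) and glue over it. *)
Lemma fact_ex (F : X (X (RA A)) -> X (RA A)) (G : X Y -> Y) :
    is_alg_map F -> is_alg_map G ->
    (forall a, F (I (I a)) = I a) -> (forall a, F (D (I a)) = 0) ->
    (forall a, G (I (q a)) = q a) -> (forall a, G (D (q a)) = 0) ->
  exists L, fact_spec F G L.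
Proof.
move=> hF hG FI FD GI GD; have [hp pI pD] := hTp; have [hq qI qD] := hTq.
have Fl := alg_map_comp (tel_map Z) hF; have Gr := alg_map_comp (ter_map Z) hG.
have [|L [hL LE]] := te_lift W (te_scalar Z) Fl Gr.
  apply: (tg_ext (alg_map_comp Fl hp) (alg_map_comp Gr hq)) => a.
  - by rewrite pI qI FI GI te_base.
  - by rewrite pD qD FD GD te0l te0r.
by exists L; split=> // x y; rewrite LE -teE.
Qed.
End BundleMaps.

(* Abstracting the structure keeps the quotient rings out of the computations
   below: a failing unification between their elements unfolds them and does not
   end in reasonable time. *)
Record bundle (R : comNzRingType) (A : comAlgType R) (M : lmodType A) := Bundle {
  bX : tangent_theory R;
  bY : sym_theory M;
  bZ : tensor_theory (@tgI R bX (RA A)) (syq bY);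
  bTF : forall B C : ralg R, (B -> C) -> bX B -> bX C;
  bW : tensor_theory (bTF (@tgI R bX (RA A))) (bTF (syq bY));
  bzero : forall B : ralg R, bX B -> B;
  bell : forall B : ralg R, bX (bX B) -> bX B;
  bflip : forall B : ralg R, bX (bX B) -> bX (bX B);
  bz : bY -> RA A;
  blam : bX bY -> bY;
  bU : bZ -> bX bY;
  btheta : bX bZ -> bW;
  bez : bW -> bZ;
  bzl : bW -> bZ;
  bTFP : forall (B C : ralg R) (h : B -> C), is_alg_map h -> TF_spec h (bTF h);
  bzeroP : forall B : ralg R, scalar_hom B -> zero_spec (@bzero B);
  bellP : forall B : ralg R, ell_spec (@bell B);
  bflipP : forall B : ralg R, flip_spec (@bflip B);
  bzP : z_spec bz;
  blamP : lam_spec blam;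
  bUP : U_spec (bTF (syq bY)) bU;
  bthetaP : theta_spec btheta;
  bezP : fact_spec (@bell (RA A)) (@bzero bY) bez;
  bzlP : fact_spec (@bzero (bX (RA A))) blam bzl }.

(** * Connections over an abstract bundle *)

Section Connections.
Variables (R : comNzRingType) (A : comAlgType R) (M : lmodType A) (G : bundle M).
Local Notation T := (bX G).
Local Notation S := (bY G).
Local Notation P := (bZ G).
Local Notation I := (tgI (bX G)).
Local Notation D := (tgD (bX G)).
Local Notation q := (syq (bY G)).
Local Notation s := (sym (bY G)).
Local Notation t := (tet (bZ G)).
Local Notation TF := (@bTF _ _ _ G _ _).
Local Notation ell := (@bell _ _ _ G _).
Local Notation flip := (@bflip _ _ _ G _).
Local Notation lam := (@blam _ _ _ G).
Local Notation U := (@bU _ _ _ G).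
Local Notation theta := (@btheta _ _ _ G).
Local Notation ez := (@bez _ _ _ G).
Local Notation zl := (@bzl _ _ _ G).

Lemma ez_thetaI w v : ez (theta (I (t w v))) = t (ell (I w)) v.
Proof.
have [_ tI _] := bthetaP G; have [_ ezE] := bezP G.
by have [_ zI _] := bzeroP G (sy_scalar S); rewrite tI ezE zI.
Qed.

(** Of the two Leibniz terms of [theta], the zero map on the second factor kills the one that
    differentiates [v]. Thus [ez] acts on [w] alone; in [zl_thetaD] the roles are reversed. *)
Lemma ez_thetaD w v : ez (theta (D (t w v))) = t (ell (D w)) v.
Proof.
have [_ _ tD] := bthetaP G; have [hez ezE] := bezP G.
have [_ zI zD] := bzeroP G (sy_scalar S).
by rewrite tD (alg_mapD hez) !ezE zI zD te0r addr0.
Qed.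

Lemma zl_thetaI w v : zl (theta (I (t w v))) = t w (lam (I v)).
Proof.
have [_ tI _] := bthetaP G; have [_ zlE] := bzlP G.
by have [_ zI _] := bzeroP G (tg_scalar T (RA A)); rewrite tI zlE zI.
Qed.

Lemma zl_thetaD w v : zl (theta (D (t w v))) = t w (lam (D v)).
Proof.
have [_ _ tD] := bthetaP G; have [hzl zlE] := bzlP G.
have [_ zI zD] := bzeroP G (tg_scalar T (RA A)).
by rewrite tD (alg_mapD hzl) !zlE zI zD te0l add0r.
Qed.

Lemma ez_theta_map : is_alg_map (fun x => ez (theta x)).
Proof. by have [h _ _] := bthetaP G; have [h' _] := bezP G; apply: alg_map_comp. Qed.

Lemma zl_theta_map : is_alg_map (fun x => zl (theta x)).
Proof. by have [h _ _] := bthetaP G; have [h' _] := bzlP G; apply: alg_map_comp. Qed.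

(** The abstract form of [OmegaM], convertible to it on [SA_bundle]. *)
Definition omega (x : P) : Prop :=
  exists r : seq (A * M), x = \sum_(p <- r) t (D (p.1 : RA A)) (s p.2).

Lemma omegaD x y : omega x -> omega y -> omega (x + y).
Proof. by move=> [r ->] [r' ->]; exists (r ++ r'); rewrite big_cat. Qed.

Lemma omega0 : omega 0.
Proof. by exists [::]; rewrite big_nil. Qed.

Lemma lam_D_sym v : exists m, lam (D v) = s m.
Proof.
have [hl lIq lIs lDq lDs] := blamP G; have hlD := comp_der hl (tgD_der T S).
(* The coefficients in the Leibniz rule of [lam (D _)] must lie in A for the value to stay in the
   image of M. *)
have hlI u : exists a, lam (I u) = q a.
  have hlI := alg_map_comp hl (tgI_map T S).
  elim/sy_ind: u => [a|m|u u' [a ha] [b hb]|u u' [a ha] [b hb]].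
  - by exists a; rewrite lIq.
  - by exists 0; rewrite lIs (alg_map0 (syq_map S)).
  - by exists (a + b); rewrite (alg_mapD hlI) ha hb (alg_mapD (syq_map S)).
  - by exists (a * b); rewrite (alg_mapM hlI) ha hb (alg_mapM (syq_map S)).
elim/sy_ind: v => [a|m|u v [m hm] [n hn]|u v [m hm] [n hn]].
- by exists 0; rewrite lDq -(scale0r 0) symZ (alg_map0 (syq_map S)) mul0r.
- by exists m.
- by exists (m + n); rewrite (derD hlD) hm hn symD.
- have [a ha] := hlI u; have [b hb] := hlI v.
  exists ((a : A) *: n + (b : A) *: m).
  by rewrite (derM hlD) ha hb hm hn symD !symZ.
Qed.

Lemma omega_ell_D w m : omega (t (ell (D w)) (s m)).
Proof.
have [hl lII lID lDI lDD] := bellP G (RA A); have hlD := comp_der hl (tgD_der T _).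
have hlI := alg_map_comp hl (tgI_map T _).
have hI u : exists a : RA A, ell (I u) = I a.
  elim/tg_ind: u => [r|a|a|u v [a ha] [b hb]|u v [a ha] [b hb]].
  - by exists (ralg_s _ r); rewrite (alg_mapS hlI) (alg_mapS (tgI_map T _)).
  - by exists a; rewrite lII.
  - by exists 0; rewrite lID (alg_map0 (tgI_map T _)).
  - by exists (a + b); rewrite (alg_mapD hlI) ha hb (alg_mapD (tgI_map T _)).
  - by exists (a * b); rewrite (alg_mapM hlI) ha hb (alg_mapM (tgI_map T _)).
(* Coefficients from A cross the tensor sign into M. The Leibniz case thereby changes [m], so the
   induction below keeps [m] general. *)
have tsc (a : A) x n : t (I (a : RA A) * x) (s n) = t x (s (a *: n)).
  rewrite teE (alg_mapM (tel_map P)) te_base [RHS]teE symZ (alg_mapM (ter_map P)).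
  by rewrite mulrAC mulrC.
elim/tg_ind: w m => [r|a|a|u v hu hv|u v hu hv] m.
- by rewrite (derS hlD) te0l; apply: omega0.
- by rewrite lDI te0l; apply: omega0.
- by exists [:: (a, m)]; rewrite big_seq1 lDD.
- rewrite (derD hlD) teE (alg_mapD (tel_map P)) mulrDl -!teE.
  exact: omegaD.
- have [a ha] := hI u; have [b hb] := hI v.
  rewrite (derM hlD) ha hb teE (alg_mapD (tel_map P)) mulrDl -!teE !tsc.
  exact: omegaD.
Qed.

(** * From a horizontal connection to a module connection *)

Section FromHorizontal.
Variable H : T S -> P.
Hypothesis hH : is_alg_map H.
Hypothesis H1 : forall w, H (TF q w) = t w 1.
Hypothesis H2 : forall v, H (I v) = t 1 v.
Hypothesis H3 : forall x, ez (theta (TF H x)) = H (ell x).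
Hypothesis H4 : forall x, zl (theta (TF H x)) = H (TF lam (flip x)).

Lemma horizontal_omega m : omega (H (D (s m))).
Proof.
have [_ _ TD] := bTFP G hH; have [_ _ _ _ lDD] := bellP G S.
have [_ _ _ _ cDD] := bflipP G S; have [hlam _ _ _ lamD] := blamP G.
have [_ _ lD] := bTFP G hlam.
(* At d'd(m) the right sides of both axioms reduce to H(d m): [ell] sends d'd(m) to d(m), the flip
   fixes it, and T([lam]) sends it to d(m). *)
have E3 := H3 (D (D (s m))); have E4 := H4 (D (D (s m))).
rewrite TD lDD in E3; rewrite TD cDD lD lamD in E4.
have [r hr] := te_sum (H (D (s m))).
have hez := comp_der ez_theta_map (tgD_der T P).
have hzl := comp_der zl_theta_map (tgD_der T P).
rewrite {1}hr (der_sum hez) in E3.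
(* Substituting the first identity into the second applies both projections in turn, so a summand w
   (x) v of H(d m) becomes [ell (D w)] (x) [lam (D v)]. *)
rewrite -{1}E3 (der_sum hzl) in E4; rewrite -E4.
elim/big_ind: _ => [|x y|p _]; [exact: omega0|exact: omegaD|].
rewrite ez_thetaD zl_thetaD; have [n ->] := lam_D_sym p.2; exact: omega_ell_D.
Qed.

Lemma horizontalD m m' : H (D (s (m + m'))) = H (D (s m)) + H (D (s m')).
Proof. by rewrite symD (derD (tgD_der T S)) (alg_mapD hH). Qed.

Lemma horizontalM (a : A) m :
  H (D (s (a *: m))) = t (I (a : RA A)) 1 * H (D (s m)) + t (D (a : RA A)) (s m).
Proof.
have [_ _ TD] := bTFP G (syq_map S).
rewrite symZ (derM (tgD_der T S)) (alg_mapD hH) !(alg_mapM hH) !H2 te_base.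
by rewrite -TD H1 [t (D _) (s m)]teE [t 1 (s m) * _]mulrC.
Qed.

Lemma horizontal_scalar (r : R) m :
  H (D (s ((r%:A : A) *: m))) = ralg_s P r * H (D (s m)).
Proof.
rewrite horizontalM (derS (tgD_der T (RA A)) r) te0l addr0; congr (_ * _).
by rewrite -(alg_mapS (tel_map P)) -(alg_mapS (tgI_map T (RA A))).
Qed.

(** (H1) and (H2) fix [H] on all generators except d(m), where its value is the connection; this
    yields the uniqueness behind the bijection. *)
Lemma horizontal_spec : [/\ is_alg_map H,
  forall a, H (I (q a)) = t (I a) 1, forall m, H (I (s m)) = t 1 (s m) &
  forall a, H (D (q a)) = t (D a) 1].
Proof.
have [_ TI TD] := bTFP G (syq_map S); split=> // [a|a].
- by rewrite H2 te_base.
- by rewrite -TD H1.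
Qed.
End FromHorizontal.

(** * From a module connection to a horizontal and a vertical connection *)

Section FromModule.
Variable nab : M -> P.
Hypothesis nab_omega : forall m, omega (nab m).
Hypothesis nabD : forall m m', nab (m + m') = nab m + nab m'.
Hypothesis nabM : forall (a : A) m,
  nab (a *: m) = t (I (a : RA A)) 1 * nab m + t (D (a : RA A)) (s m).

Definition H_spec (H : T S -> P) : Prop :=
  [/\ is_alg_map H, forall a, H (I (q a)) = t (I a) 1,
      forall m, H (I (s m)) = t 1 (s m), forall a, H (D (q a)) = t (D a) 1 &
      forall m, H (D (s m)) = nab m].

Definition K_spec (K : S -> T S) : Prop :=
  [/\ is_alg_map K, forall a, K (q a) = I (q a) &
      forall m, K (s m) = D (s m) - U (nab m)].

Lemma H_ex : exists H, H_spec H.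
Proof.
have hl := tel_map P; have hr := ter_map P.
apply: (tgsy_lift T S (mu := fun m => t 1 (s m)) (nu := nab) (te_scalar P)
  (alg_map_comp hl (tgI_map T _)) (comp_der hl (tgD_der T _))).
- by move=> m m'; rewrite symD (alg_mapD hr).
- by move=> a m; rewrite symZ (alg_mapM hr) te_base.
- exact: nabD.
- by move=> a m; rewrite nabM [t (D _) (s m)]teE [t 1 (s m) * _]mulrC.
Qed.

Lemma U_t w v : U (t w v) = TF q w * I v. Proof. by case: (bUP G). Qed.

Lemma U_map : is_alg_map U. Proof. by case: (bUP G). Qed.

Lemma K_ex : exists K, K_spec K.
Proof.
have [hT TI TD] := bTFP G (syq_map S); have hD := tgD_der T S; have hI := tgI_map T S.
apply: (sy_lift S (tg_scalar T S) (alg_map_comp hI (syq_map S))).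
- move=> m m'; rewrite symD (derD hD) nabD (alg_mapD U_map) opprD.
  by rewrite addrACA.
(* Both d(am) and U(nabla(am)) contain the term d(a) m. It cancels in the difference, which is
   therefore A-linear in m although neither part is. *)
- move=> a m; rewrite symZ (derM hD) nabM (alg_mapD U_map) (alg_mapM U_map) !U_t.
  rewrite TI TD (alg_map1 hI) mulr1 [D (q a) * _]mulrC mulrBr.
  by rewrite [X in _ - X]addrC opprD addrA addrK.
Qed.

Lemma H_unique H H' : H_spec H -> H_spec H' -> H =1 H'.
Proof.
move=> [h h1 h2 h3 h4] [h' h1' h2' h3' h4'].
by apply: (tgsy_ext h h') => x; rewrite ?h1 ?h2 ?h3 ?h4.
Qed.

Lemma K_unique K K' : K_spec K -> K_spec K' -> K =1 K'.
Proof.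
move=> [h h1 h2] [h' h1' h2'].
by apply: (sy_ext h h') => x; rewrite ?h1 ?h2.
Qed.

Section H.
Variable H : T S -> P.
Hypothesis hH : H_spec H.

Lemma H_TFq w : H (TF q w) = t w 1.
Proof.
have [hA HIq _ HDq _] := hH; have [hT TI TD] := bTFP G (syq_map S).
apply: (tg_ext (alg_map_comp hA hT) (tel_map P)) => a.
- by rewrite TI HIq.
- by rewrite TD HDq.
Qed.

Lemma H_I v : H (I v) = t 1 v.
Proof.
have [hA HIq HIs _ _] := hH.
apply: (sy_ext (alg_map_comp hA (tgI_map T S)) (ter_map P)) => // a.
by rewrite HIq te_base.
Qed.

Lemma H_ell x : ez (theta (TF H x)) = H (ell x).
Proof.
have [hA HIq HIs HDq HDs] := hH; have [hT TI TD] := bTFP G hA.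
have [hl lII lID lDI lDD] := bellP G S.
have [hk kII kID kDI kDD] := bellP G (RA A).
(* The generators 1 (x) m have unit first factor, so the values of the two composites at 1 are
   needed: 1 for the algebra map, 0 for the derivation. *)
have hkI1 := alg_map1 (alg_map_comp hk (tgI_map T _)).
have hkD1 := der1 (alg_map_comp hk (tgI_map T _)) (comp_der hk (tgD_der T _)).
have hez := comp_der ez_theta_map (tgD_der T P).
apply: (tg2sy_ext (alg_map_comp ez_theta_map hT) (alg_map_comp hA hl)).
- by move=> a; rewrite TI lII HIq ez_thetaI kII.
- by move=> m; rewrite TI lII HIs ez_thetaI hkI1.
- by move=> a; rewrite TI lID HDq ez_thetaI kID te0l (alg_map0 hA).
(* The connection enters only at d(m) and d'd(m). Here each summand d(a) (x) m' is killed, because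
   [ell] sends d(a) to 0; at d'd(m) each summand is fixed. *)
- move=> m; rewrite TI lID HDs (alg_map0 hA); have [r ->] := nab_omega m.
  rewrite (alg_map_sum (alg_map_comp ez_theta_map (tgI_map T P))) big1 // => p _.
  by rewrite ez_thetaI kID te0l.
- by move=> a; rewrite TD lDI HIq ez_thetaD kDI te0l (alg_map0 hA).
- by move=> m; rewrite TD lDI HIs ez_thetaD hkD1 te0l (alg_map0 hA).
- by move=> a; rewrite TD lDD HDq ez_thetaD kDD.
- move=> m; rewrite TD lDD HDs; have [r ->] := nab_omega m.
  by rewrite (der_sum hez); apply: eq_bigr => p _; rewrite ez_thetaD kDD.
Qed.

Lemma H_lam x : zl (theta (TF H x)) = H (TF lam (flip x)).
Proof.
have [hA HIq HIs HDq HDs] := hH; have [hT TI TD] := bTFP G hA.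
have [hc cII cID cDI cDD] := bflipP G S.
have [hl lIq lIs lDq lDs] := blamP G; have [hL LI LD] := bTFP G hl.
have hlI1 := alg_map1 (alg_map_comp hl (tgI_map T _)).
have hlD1 := der1 (alg_map_comp hl (tgI_map T _)) (comp_der hl (tgD_der T _)).
have hzl := comp_der zl_theta_map (tgD_der T P).
have I0 := alg_map0 (tgI_map T S); have D0 := der0 (tgD_der T S); have H0 := alg_map0 hA.
apply: (tg2sy_ext (alg_map_comp zl_theta_map hT) (alg_map_comp hA (alg_map_comp hL hc))).
- by move=> a; rewrite TI cII LI lIq HIq zl_thetaI hlI1.
- by move=> m; rewrite TI cII LI lIs I0 H0 HIs zl_thetaI lIs te0r.
- by move=> a; rewrite TI cID LD lIq HDq zl_thetaI hlI1.
(* Mirror image of [H_ell]: now degree one in S_A(M) matters, since [lam] sends m' to 0 and d(m') to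
   m'. *)
- move=> m; rewrite TI cID LD lIs D0 H0 HDs; have [r ->] := nab_omega m.
  rewrite (alg_map_sum (alg_map_comp zl_theta_map (tgI_map T P))) big1 // => p _.
  by rewrite zl_thetaI lIs te0r.
- by move=> a; rewrite TD cDI LI lDq I0 H0 HIq zl_thetaD hlD1 te0r.
- by move=> m; rewrite TD cDI LI lDs !HIs zl_thetaD lDs.
- by move=> a; rewrite TD cDD LD lDq D0 H0 HDq zl_thetaD hlD1 te0r.
- move=> m; rewrite TD cDD LD lDs !HDs; have [r ->] := nab_omega m.
  by rewrite (der_sum hzl); apply: eq_bigr => p _; rewrite zl_thetaD lDs.
Qed.

Variable K : S -> T S.
Hypothesis hK : K_spec K.

Lemma nab_U m :
  exists r : seq (A * M), U (nab m) = \sum_(p <- r) D (q p.1) * I (s p.2).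
Proof.
have [r ->] := nab_omega m; exists r; have [_ _ TD] := bTFP G (syq_map S).
by rewrite (alg_map_sum U_map); apply: eq_bigr => p _; rewrite U_t TD.
Qed.

(** On w (x) v this is the product of (H1) and (H2). As a consequence H(K(m)) = nabla(m) - nabla(m)
    = 0. *)
Lemma H_U x : H (U x) = x.
Proof.
have [hA _ _ _ _] := hH.
apply: (te_ext (alg_map_comp hA U_map) (alg_map_id P)) => w v.
by rewrite U_t (alg_mapM hA) H_TFq H_I -teE.
Qed.

Lemma H_comp_K v : H (K v) = t 1 (q (@bz _ _ _ G v)).
Proof.
have [hA HIq HIs HDq HDs] := hH; have [hk Kq Ks] := hK; have [hz zq zs] := bzP G.
apply: (sy_ext (alg_map_comp hA hk)
  (alg_map_comp (ter_map P) (alg_map_comp (syq_map S) hz))).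
- by move=> a; rewrite Kq HIq zq te_base.
- move=> m; rewrite Ks (alg_mapD hA) (alg_mapN hA) HDs H_U subrr zs.
  by rewrite (alg_map0 (syq_map S)) te0r.
Qed.

Lemma lam_K v : lam (K v) = v.
Proof.
have [hk Kq Ks] := hK; have [hl lIq lIs lDq lDs] := blamP G.
apply: (sy_ext (alg_map_comp hl hk) (alg_map_id S)).
- by move=> a; rewrite Kq lIq.
- move=> m; rewrite Ks (alg_mapD hl) (alg_mapN hl) lDs; have [r ->] := nab_U m.
  (* The correction term is a sum of products d(a) m', and [lam] kills d(a). *)
  rewrite (alg_map_sum hl) big1 ?subr0 // => p _.
  by rewrite (alg_mapM hl) lDq mul0r.
Qed.

Lemma ell_K x : ell (TF K x) = K (lam x).
Proof.
have [hk Kq Ks] := hK; have [hl lIq lIs lDq lDs] := blamP G.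
have [hT TI TD] := bTFP G hk; have [he eII eID eDI eDD] := bellP G S.
have heI := alg_map_comp he (tgI_map T _); have heD := comp_der he (tgD_der T _).
apply: (tgsy_ext (alg_map_comp he hT) (alg_map_comp hk hl)).
- by move=> a; rewrite TI Kq eII lIq Kq.
- move=> m; rewrite TI Ks lIs (alg_map0 hk) (alg_mapD heI) (alg_mapN heI) eID.
  have [r ->] := nab_U m; rewrite (alg_map_sum heI) big1 ?subr0 // => p _.
  by rewrite (alg_mapM heI) eID mul0r.
- by move=> a; rewrite TD Kq eDI lDq (alg_map0 hk).
- move=> m; rewrite TD Ks lDs Ks (derD heD) (derN heD) eDD; congr (_ - _).
  have [r ->] := nab_U m; rewrite (der_sum heD); apply: eq_bigr => p _.
  by rewrite (derM heD) eID mul0r add0r eII eDD mulrC.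
Qed.

Lemma lam_flip_K x : TF lam (flip (TF K x)) = K (lam x).
Proof.
have [hk Kq Ks] := hK; have [hl lIq lIs lDq lDs] := blamP G.
have [hT TI TD] := bTFP G hk; have [hc cII cID cDI cDD] := bflipP G S.
have [hL LI LD] := bTFP G hl; have hLc := alg_map_comp hL hc.
have hI := alg_map_comp hLc (tgI_map T _); have hD := comp_der hLc (tgD_der T _).
have I0 := alg_map0 (tgI_map T S); have D0 := der0 (tgD_der T S).
apply: (tgsy_ext (alg_map_comp hLc hT) (alg_map_comp hk hl)).
- by move=> a; rewrite TI Kq cII LI !lIq Kq.
- move=> m; rewrite TI Ks lIs (alg_map0 hk) (alg_mapD hI) (alg_mapN hI) cID LD lIs D0.
  have [r ->] := nab_U m; rewrite (alg_map_sum hI) big1 ?subr0 // => p _.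
  by rewrite (alg_mapM hI) cII LI lIs I0 mulr0.
- by move=> a; rewrite TD Kq cDI LI lDq I0 (alg_map0 hk).
- move=> m; rewrite TD Ks lDs Ks (derD hD) (derN hD) cDD LD lDs; congr (_ - _).
  have [r ->] := nab_U m; rewrite (der_sum hD); apply: eq_bigr => p _.
  (* In contrast to [ell_K], the surviving term is d(a) d'(m'): the flip turns it into d'(a) d(m'),
     and T([lam]) gives d(a) m'. *)
  by rewrite (derM hD) cDI LI lDs cID LD lIq cII LI lIs I0 mul0r addr0.
Qed.
End H.
End FromModule.
End Connections.

(** * Transfer to the presented algebras and their chosen structure maps *)

Section ConcreteBundle.
Variables (R : comNzRingType) (A : comAlgType R) (M : lmodType A).
Local Notation X := (TT_theory R).
Local Notation Y := (SA_theory M).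
Local Notation Z := (Tens_theory (@pA R A) (@sq R A M)).
Local Notation W := (Tens_theory (TF (@pA R A)) (TF (@sq R A M))).

Lemma TFP (B C : ralg R) (h : B -> C) : is_alg_map h -> TF_spec (X := X) h (TF h).
Proof. by move=> hh; apply: (the_mapP (TF_ex X hh)). Qed.

Lemma zeroTP (B : ralg R) : scalar_hom B -> zero_spec (X := X) (@zeroT R B).
Proof. by move=> hB; apply: (the_mapP (zero_ex X hB)). Qed.

Lemma ellTP (B : ralg R) : ell_spec (X := X) (@ellT R B).
Proof. exact: (the_mapP (ell_ex X B)). Qed.

Lemma flipTP (B : ralg R) : flip_spec (X := X) (@flipT R B).
Proof. exact: (the_mapP (flip_ex X B)). Qed.

Lemma zMP : z_spec (Y := Y) (@zM R A M).
Proof. exact: (the_mapP (z_ex Y)). Qed.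

Lemma lamMP : lam_spec (X := X) (Y := Y) (@lamM R A M).
Proof. exact: (the_mapP (lam_ex X Y)). Qed.

Lemma TFpP : TF_spec (X := X) (@tI R (RA A)) (TF (@pA R A)).
Proof. by apply: TFP; apply: tI_alg_map. Qed.

Lemma TFqP : TF_spec (X := X) (@sq R A M) (TF (@sq R A M)).
Proof. by apply: TFP; apply: sq_alg_map. Qed.

Lemma UMP : U_spec (X := X) (Y := Y) (Z := Z) (TF (@sq R A M)) (@UM R A M).
Proof. exact: (the_mapP (U_ex (X := X) (Y := Y) Z TFqP)). Qed.

Lemma thetaMP : theta_spec (X := X) (Y := Y) (Z := Z) (W := W) (@thetaM R A M).
Proof. exact: (the_mapP (theta_ex (X := X) (Y := Y) Z TFpP TFqP W)). Qed.

Lemma ell_zeroP : fact_spec (X := X) (Y := Y) (Z := Z) (W := W)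
  (@ellT R (RA A)) (@zeroT R (SA M)) (@ell_zero R A M).
Proof.
have [hl lII lID lDI lDD] := ellTP (RA A).
have [hz zI zD] := zeroTP (pres_scalar_hom (@S_rels R A M)).
exact: (the_mapP (fact_ex (X := X) (Y := Y) Z TFpP TFqP W hl hz lII lDI
  (fun a => zI (sq M a)) (fun a => zD (sq M a)))).
Qed.

Lemma zero_lamP : fact_spec (X := X) (Y := Y) (Z := Z) (W := W)
  (@zeroT R (TT (RA A))) (@lamM R A M) (@zero_lam R A M).
Proof.
have [hl lIq lIm lDq lDm] := lamMP.
have [hz zI zD] := zeroTP (pres_scalar_hom (@T_rels R (RA A))).
exact: (the_mapP (fact_ex (X := X) (Y := Y) Z TFpP TFqP W hz hl
  (fun a => zI (tI a)) (fun a => zD (tI a)) lIq lDq)).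
Qed.

Definition SA_bundle : bundle M :=
  @Bundle R A M X Y Z (@TF R) W (@zeroT R) (@ellT R) (@flipT R) (@zM R A M)
    (@lamM R A M) (@UM R A M) (@thetaM R A M) (@ell_zero R A M) (@zero_lam R A M)
    TFP zeroTP ellTP flipTP zMP lamMP UMP thetaMP ell_zeroP zero_lamP.

Lemma H_ofP (nab : M -> TAS M) : module_connection nab ->
  H_spec (G := SA_bundle) nab (H_of nab).
Proof.
case=> _ nabD _ nabM; exact: (the_mapP (H_ex (G := SA_bundle) nabD nabM)).
Qed.

Lemma K_ofP (nab : M -> TAS M) : module_connection nab ->
  K_spec (G := SA_bundle) nab (K_of nab).
Proof.
case=> _ nabD _ nabM; exact: (the_mapP (K_ex (G := SA_bundle) nabD nabM)).
Qed.

Lemma horizontal_H_of (nab : M -> TAS M) : module_connection nab -> horizontal (H_of nab).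
Proof.
move=> hn; have hH := H_ofP hn; have [hA _ _ _ _] := hH; have [homega _ _ _] := hn.
split; first exact: hA.
- exact: (H_TFq (G := SA_bundle) hH).
- exact: (H_I (G := SA_bundle) hH).
- exact: (H_ell (G := SA_bundle) homega hH).
- exact: (H_lam (G := SA_bundle) homega hH).
Qed.

Lemma tc_connection_of (nab : M -> TAS M) : module_connection nab ->
  tc_connection (K_of nab) (H_of nab).
Proof.
move=> hn; have hH := H_ofP hn; have hK := K_ofP hn.
have [homega _ _ _] := hn; have [hKm Kq Ks] := hK; have [_ _ _ _ Hs] := hH.
split.
- split; first exact: hKm.
  + exact: (lam_K (G := SA_bundle) homega hK).
  + exact: Kq.
  + exact: (ell_K (G := SA_bundle) homega hK).
  + exact: (lam_flip_K (G := SA_bundle) homega hK).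
- exact: horizontal_H_of.
- exact: (H_comp_K (G := SA_bundle) hH hK).
- move=> m; transitivity (tD (sm m) - UM (nab m) + UM (nab m)); last exact: subrK.
  by congr (_ + UM _); [exact: Ks|exact: Hs].
Qed.

Lemma module_connection_nabla_of (H : TS M -> TAS M) :
  horizontal H -> module_connection (nabla_of H).
Proof.
case=> hH H1 H2 H3 H4; split.
- exact: (horizontal_omega (G := SA_bundle) hH H3 H4).
- exact: (horizontalD (G := SA_bundle) hH).
- exact: (horizontal_scalar (G := SA_bundle) hH H1 H2).
- exact: (horizontalM (G := SA_bundle) hH H1 H2).
Qed.

Lemma horizontal_H_spec (H : TS M -> TAS M) :
  horizontal H -> H_spec (G := SA_bundle) (nabla_of H) H.
Proof.
case=> hH H1 H2 _ _.
by have [h1 h2 h3 h4] := horizontal_spec (G := SA_bundle) hH H1 H2.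
Qed.

Lemma H_of_nabla_of (H : TS M -> TAS M) : horizontal H -> H_of (nabla_of H) =1 H.
Proof.
move=> hH; apply: (H_unique (G := SA_bundle) (H_ofP (module_connection_nabla_of hH))).
exact: horizontal_H_spec.
Qed.

(** The last condition on a pair forces K(m) = d(m) - U(H(d m)), so the horizontal part determines
    the vertical one. *)
Lemma K_of_nabla_of (K : SA M -> TS M) (H : TS M -> TAS M) :
  tc_connection K H -> K_of (nabla_of H) =1 K.
Proof.
case=> [[hK _ Kq _ _] hH _ KU].
apply: (K_unique (G := SA_bundle) (K_ofP (module_connection_nabla_of hH))).
split; [exact: hK|exact: Kq|move=> m].
transitivity (K (sm m) + UM (nabla_of H m) - UM (nabla_of H m)).
  exact/esym/addrK.
by congr (_ - _); apply: KU.
Qed.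
End ConcreteBundle.

Theorem mainTheorem8 (R : comNzRingType) (A : comAlgType R) (M : lmodType A) :
  [/\ (forall nab : M -> TAS M, module_connection nab ->
         tc_connection (K_of nab) (H_of nab)),
      (forall K H, @tc_connection R A M K H -> module_connection (nabla_of H)),
      (forall nab : M -> TAS M, module_connection nab ->
         nabla_of (H_of nab) =1 nab),
      (forall K H, @tc_connection R A M K H ->
         K_of (nabla_of H) =1 K /\ H_of (nabla_of H) =1 H) &
      [/\ forall nab : M -> TAS M, module_connection nab -> horizontal (H_of nab),
          forall H, @horizontal R A M H -> module_connection (nabla_of H) &
          forall H, @horizontal R A M H -> H_of (nabla_of H) =1 H]].
Proof.
split.
- exact: tc_connection_of.
- by move=> K H [_ hH _ _]; apply: module_connection_nabla_of.
- by move=> nab /H_ofP [].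
- move=> K H hKH; split; first exact: K_of_nabla_of hKH.
  by case: hKH => _ hH _ _; apply: H_of_nabla_of.
- split; [exact: horizontal_H_of|exact: module_connection_nabla_of|].
  exact: H_of_nabla_of.
Qed.
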